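(* Let $\mu_0,\mu_1\in\mathcal M(\Omega)$, let $\gamma$ be an optimal plan for optimal lifts of $\mu_0,\mu_1$, and consider the geodesic curve $\mu(s)=\mathfrak P\big(Z(s;\cdot,\cdot)_\#\gamma\big)$, $s\in[0,1]$, in $(\mathcal M(\Omega),\mathsf{HK})$. Set $m(s):=\mu(s)(\Omega)$. Then for all $s\in[0,1]$ $$m(s)=(1-s)^2m(0)+s^2m(1)+2s(1-s)m_*,\qquad m_*:=\int_{\mathfrak C_\Omega\times\mathfrak C_\Omega}r_0r_1\cos_\pi(|x_1-x_0|)\,\mathrm d\gamma([x_0,r_0],[x_1,r_1]),$$ and (the first inequality being for $m(0)+m(1)>0$) $$\frac{m(0)m(1)}{m(0)+m(1)}\le(1-s)^2m(0)+s^2m(1)\le m(s)\le\Big((1-s)\sqrt{m(0)}+s\sqrt{m(1)}\Big)^2.$$ Moreover, $m''(s)=2\,\mathsf{HK}(\mu_0,\mu_1)^2\ge0$, which implies $$m(s)=(1-s)m(0)+s\,m(1)-s(1-s)\,\mathsf{HK}(\mu_0,\mu_1)^2.$$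
   Context: $\Omega\subset\mathbb R^d$ is convex and compact; $\mathcal M(\Omega)$ is the set of finite nonnegative Borel measures on $\Omega$. The cone over $\Omega$ is $\mathfrak C_\Omega:=(\Omega\times[0,\infty[)/(\Omega\times\{0\})$, with points $[x,r]$ and tip $\mathfrak o=[x,0]$, and metric $\mathsf d_{\mathfrak C}([x_0,r_0],[x_1,r_1])^2=r_0^2+r_1^2-2r_0r_1\cos_\pi(|x_0-x_1|)$, $\cos_\pi(L)=\cos(\min\{L,\pi\})$. $\mathcal M_2(\mathfrak C_\Omega)$ is the set of finite nonnegative Borel measures with $\int r^2\mathrm d\lambda<\infty$. $\mathsf W_{\mathfrak C}(\lambda_0,\lambda_1)^2=\inf\iint\mathsf d_{\mathfrak C}^2\,\mathrm d\gamma$ over nonnegative measures $\gamma$ on $\mathfrak C_\Omega\times\mathfrak C_\Omega$ with marginals $\lambda_0,\lambda_1$ ($=\infty$ if the masses differ); minimizers are optimal plans. The projection $\mathfrak P:\mathcal M_2(\mathfrak C_\Omega)\to\mathcal M(\Omega)$ is given by $\int_\Omega\phi\,\mathrm d\mathfrak P\lambda=\int r^2\phi(x)\,\mathrm d\lambda([x,r])$, $\phi\in\mathrm C^0(\Omega)$; $\lambda$ is a lift of $\mu$ if $\mathfrak P\lambda=\mu$. The Hellinger–Kantorovich distance is $\mathsf{HK}(\mu_0,\mu_1)=\min\{\mathsf W_{\mathfrak C}(\lambda_0,\lambda_1)\mid\mathfrak P\lambda_j=\mu_j\}$; minimizing pairs are optimal lifts. $Z(\cdot;z_0,z_1)=[X,R]:[0,1]\to\mathfrak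 C_\Omega$ is the unique constant-speed minimal geodesic in $(\mathfrak C_\Omega,\mathsf d_{\mathfrak C})$ from $z_0=[x_0,r_0]$ to $z_1=[x_1,r_1]$; its radial part satisfies $R(s;z_0,z_1)^2=(1-s)^2r_0^2+s^2r_1^2+2s(1-s)r_0r_1\cos_\pi(|x_0-x_1|)$. *)

(* Defs.v *)
From HB Require Import structures.
From mathcomp Require Import all_boot all_order all_algebra generic_quotient.
From mathcomp Require Import all_classical all_reals all_analysis.
From mathcomp Require Import ring lra.

Set Implicit Arguments.
Unset Strict Implicit.
Unset Printing Implicit Defensive.

Import Order.TTheory GRing.Theory Num.Theory.
Import numFieldTopology.Exports numFieldNormedType.Exports.

Local Open Scope classical_set_scope.
Local Open Scope ring_scope.
Local Open Scope quotient_scope.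

(* The library norm on row vectors is the sup norm; it induces the same
   topology as the Euclidean norm below, so [compact], [continuous] and the
   Borel sets are the usual ones. *)
Definition enorm {R : realType} {d : nat} (v : 'rV[R]_d) : R :=
  Num.sqrt (\sum_i v 0 i ^+ 2).

Section euclidean_norm.
Context {R : realType} {d : nat}.
Implicit Types u v w : 'rV[R]_d.

Lemma enorm_ge0 v : 0 <= enorm v. Proof. exact: sqrtr_ge0. Qed.

Lemma sqr_enorm v : enorm v ^+ 2 = \sum_i v 0 i ^+ 2.
Proof. by rewrite sqr_sqrtr// sumr_ge0// => i _; rewrite sqr_ge0. Qed.

Lemma enorm0 : enorm (0 : 'rV[R]_d) = 0.
Proof.
by rewrite /enorm big1 ?sqrtr0// => i _; rewrite mxE expr0n.
Qed.

Lemma enorm_eq0 v : enorm v = 0 -> v = 0.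
Proof.
move=> v0; have := sqr_enorm v; rewrite v0 expr0n/= => /esym/eqP.
rewrite psumr_eq0 => [/allP h|i _]; last exact: sqr_ge0.
apply/rowP => i; rewrite mxE; apply/eqP.
by have := h i; rewrite mem_index_enum sqrf_eq0 => /(_ isT).
Qed.

Lemma enormN v : enorm (- v) = enorm v.
Proof.
by rewrite /enorm; congr Num.sqrt; apply: eq_bigr => i _; rewrite mxE sqrrN.
Qed.

Let dot u v := \sum_i u 0 i * v 0 i.

Let dot_le u v : dot u v <= enorm u * enorm v.
Proof.
have h (a b : R) :
    \sum_i (a * u 0 i - b * v 0 i) ^+ 2 =
    a ^+ 2 * enorm u ^+ 2 + b ^+ 2 * enorm v ^+ 2 - 2 * a * b * dot u v.
  rewrite !sqr_enorm /dot !mulr_sumr -big_split -sumrB.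
  by apply: eq_bigr => i _ /=; ring.
have hp (a b : R) : 0 <= \sum_i (a * u 0 i - b * v 0 i) ^+ 2.
  by rewrite sumr_ge0// => i _; exact: sqr_ge0.
have [u0|u0] := eqVneq (enorm u) 0.
  rewrite u0 mul0r (enorm_eq0 u0) /dot big1// => i _.
  by rewrite mxE mul0r.
have [v0|v0] := eqVneq (enorm v) 0.
  rewrite v0 mulr0 (enorm_eq0 v0) /dot big1// => i _.
  by rewrite mxE mulr0.
have up : 0 < enorm u by rewrite lt_def u0 enorm_ge0.
have vp : 0 < enorm v by rewrite lt_def v0 enorm_ge0.
have := hp (enorm v) (enorm u); rewrite h.
rewrite (_ : _ - _ =
   2 * (enorm u * enorm v) * (enorm u * enorm v - dot u v)); last by ring.
by rewrite pmulr_rge0 ?subr_ge0// !mulr_gt0.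
Qed.

Lemma enormD u v : enorm (u + v) <= enorm u + enorm v.
Proof.
rewrite -(@ler_pXn2r _ 2)// ?nnegrE ?addr_ge0 ?enorm_ge0//.
rewrite (_ : enorm (u + v) ^+ 2 =
    enorm u ^+ 2 + enorm v ^+ 2 + 2 * dot u v); last first.
  rewrite !sqr_enorm /dot mulr_sumr -!big_split.
  by apply: eq_bigr => i _; rewrite mxE /=; ring.
by rewrite sqrrD; have := dot_le u v; lra.
Qed.

Lemma enorm_dist_triangle v u w :
  enorm (u - w) <= enorm (u - v) + enorm (v - w).
Proof. by rewrite (le_trans _ (enormD _ _))// addrA subrK. Qed.

End euclidean_norm.

(* Nonemptiness is needed for the tip of the cone to exist; it also provides
   the distinguished point which the library demands of measurable spaces. *)
Record domain (R : realType) (d : nat) := Domain {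
  domain_set : set 'rV[R]_d ;
  domain_convex : convex_set domain_set ;
  domain_compact : compact domain_set ;
  domain_nonempty : domain_set !=set0 }.

Section domain_type.
Context {R : realType} {d : nat} (Omega : domain R d).

Definition pts : Type := set_type (domain_set Omega).

HB.instance Definition _ := Topological.copy pts (set_type (domain_set Omega)).

Lemma pts_nonempty : exists x : pts, True.
Proof.
have [x xO] := domain_nonempty Omega.
by exists (exist _ x (mem_set xO)).
Qed.

HB.instance Definition _ :=
  isPointed.Build pts (projT1 (cid pts_nonempty)).

HB.instance Definition _ :=
  Measurable.copy pts (g_sigma_algebraType (@open pts)).

Definition pt_coord (x : pts) : 'rV[R]_d := \val x.

Definition eucl_dist (x y : pts) : R := enorm (pt_coord x - pt_coord y).

Lemma eucl_dist_ge0 x y : 0 <= eucl_dist x y. Proof. exact: enorm_ge0. Qed.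

Lemma eucl_distxx x : eucl_dist x x = 0.
Proof. by rewrite /eucl_dist subrr enorm0. Qed.

Lemma eucl_dist_sym x y : eucl_dist x y = eucl_dist y x.
Proof. by rewrite /eucl_dist -enormN opprB. Qed.

Lemma eucl_dist_triangle y x z : eucl_dist x z <= eucl_dist x y + eucl_dist y z.
Proof. exact: enorm_dist_triangle. Qed.

Lemma eucl_dist_eq0 x y : eucl_dist x y = 0 -> x = y.
Proof. by move=> /enorm_eq0/subr0_eq; exact: val_inj. Qed.

End domain_type.

Coercion pts : domain >-> Sortclass.

Definition cos_pi {R : realType} (L : R) : R := cos (Num.min L pi).

Section cos_pi.
Context {R : realType}.
Implicit Types a b c L : R.

Lemma cos_pi_ge0 L : cos_pi L >= -1. Proof. exact: cos_geN1. Qed.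

Lemma cos_pi_le1 L : cos_pi L <= 1. Proof. exact: cos_le1. Qed.

Lemma cos_pi0 : cos_pi 0 = 1 :> R.
Proof. by rewrite /cos_pi minElt pi_gt0 cos0. Qed.

Lemma cos_pi_eq1 L : 0 <= L -> cos_pi L = 1 -> L = 0.
Proof.
move=> L0; rewrite /cos_pi -[X in _ = X]cos0 => /cos_inj.
have p0 := pi_gt0 R; rewrite !in_itv/= le_min L0 (ltW p0) ge_min !lexx orbT/=.
by move=> /(_ isT isT); case: ltP => // _ p; move: p0; rewrite p ltxx.
Qed.

Lemma le_cos_pi a b : 0 <= a -> a <= b -> cos_pi b <= cos_pi a.
Proof.
have p0 := pi_ge0 R; move=> a0 ab; rewrite /cos_pi leNgt ltr_cos ?in_itv/=.
- by rewrite -leNgt le_min !ge_min ab lexx orbT.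
- by rewrite le_min (le_trans a0 ab) p0 ge_min lexx orbT.
- by rewrite le_min a0 p0 ge_min lexx orbT.
Qed.

Let planar_triangle r0 r1 r2 ca sa cb sb :
    ca ^+ 2 + sa ^+ 2 = 1 -> cb ^+ 2 + sb ^+ 2 = 1 :> R ->
  Num.sqrt (r0 ^+ 2 + r2 ^+ 2 - 2 * r0 * r2 * (ca * cb - sa * sb)) <=
  Num.sqrt (r0 ^+ 2 + r1 ^+ 2 - 2 * r0 * r1 * ca) +
  Num.sqrt (r1 ^+ 2 + r2 ^+ 2 - 2 * r1 * r2 * cb).
Proof.
move=> ha hb.
pose u : 'rV[R]_2 := \row_i (if i == 0 then r0 * ca - r1 else r0 * sa).
pose v : 'rV[R]_2 := \row_i (if i == 0 then r1 - r2 * cb else r2 * sb).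
have e2 (w : 'rV[R]_2) : enorm w = Num.sqrt (w 0 0 ^+ 2 + w 0 1 ^+ 2).
  rewrite /enorm !big_ord_recl big_ord0 addr0.
  by congr (Num.sqrt (_ + w _ _ ^+ 2)); apply/val_inj.
have := enormD u v; rewrite !e2 !mxE /=.
have e (A B C D E F : R) : A = B -> C = D -> E = F ->
  Num.sqrt A <= Num.sqrt C + Num.sqrt E -> Num.sqrt B <= Num.sqrt D + Num.sqrt F.
  by move=> -> -> ->.
apply: e.
- transitivity (r0 ^+ 2 * (ca ^+ 2 + sa ^+ 2) + r2 ^+ 2 * (cb ^+ 2 + sb ^+ 2)
    - 2 * r0 * r2 * (ca * cb - sa * sb)); first by ring.
  by rewrite ha hb; ring.
- transitivity (r0 ^+ 2 * (ca ^+ 2 + sa ^+ 2) + r1 ^+ 2 - 2 * r0 * r1 * ca).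
    by ring.
  by rewrite ha; ring.
- transitivity (r2 ^+ 2 * (cb ^+ 2 + sb ^+ 2) + r1 ^+ 2 - 2 * r1 * r2 * cb).
    by ring.
  by rewrite hb; ring.
Qed.

Let sqrt_lb (r s c : R) : -1 <= c <= 1 ->
  r - s * c <= Num.sqrt (r ^+ 2 + s ^+ 2 - 2 * r * s * c).
Proof.
move=> /andP[c1 c2]; rewrite (le_trans (ler_norm _))// -sqrtr_sqr ler_wsqrtr//.
rewrite -subr_ge0 (_ : _ - _ = s ^+ 2 * ((1 - c) * (1 + c))); last by ring.
by rewrite mulr_ge0 ?sqr_ge0// mulr_ge0//; lra.
Qed.

Lemma cone_triangle (r0 r1 r2 a b c : R) :
    0 <= r0 -> 0 <= r1 -> 0 <= r2 -> 0 <= a -> 0 <= b -> 0 <= c ->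
    c <= a + b ->
  Num.sqrt (r0 ^+ 2 + r2 ^+ 2 - 2 * r0 * r2 * cos_pi c) <=
  Num.sqrt (r0 ^+ 2 + r1 ^+ 2 - 2 * r0 * r1 * cos_pi a) +
  Num.sqrt (r1 ^+ 2 + r2 ^+ 2 - 2 * r1 * r2 * cos_pi b).
Proof.
move=> h0 h1 h2 a0 b0 c0 cab; have p0 := pi_gt0 R.
have [abp|abp] := leP (a + b) pi.
  apply: le_trans (planar_triangle _ _ _ (cos2Dsin2 _) (cos2Dsin2 _)).
  rewrite ler_wsqrtr// lerD2l lerN2 ler_wpM2l ?mulr_ge0//.
  rewrite -cosD !min_l; [|by lra..].
  by have := le_cos_pi c0 cab; rewrite {1}/cos_pi min_l.
apply: (@le_trans _ _ (r0 + r2)).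
  rewrite -[leRHS]ger0_norm ?addr_ge0// -sqrtr_sqr ler_wsqrtr//.
  have := cos_pi_ge0 c; have : 0 <= r0 * r2 by rewrite mulr_ge0.
  by nra.
have ha := sqrt_lb r0 r1 (_ : -1 <= cos_pi a <= 1).
have hb := sqrt_lb r2 r1 (_ : -1 <= cos_pi b <= 1).
rewrite cos_pi_ge0 cos_pi_le1 in ha; rewrite cos_pi_ge0 cos_pi_le1 in hb.
have {}ha := ha isT; have {}hb := hb isT.
rewrite (_ : r1 ^+ 2 + r2 ^+ 2 - _ = r2 ^+ 2 + r1 ^+ 2 - 2 * r2 * r1 * cos_pi b);
  last by ring.
apply: le_trans (lerD ha hb).
suff : r1 * (cos_pi a + cos_pi b) <= 0 by lra.
rewrite mulr_ge0_le0//.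
have [ap|ap] := leP a pi.
  have -> : cos_pi a = - cos (pi - a).
    by rewrite /cos_pi min_l// addrC cosDpi cosN opprK.
  have : cos_pi b <= cos_pi (pi - a) by apply: le_cos_pi; lra.
  by rewrite {2}/cos_pi min_l; lra.
have -> : cos_pi a = -1 by rewrite /cos_pi min_r ?cospi// ltW.
by have := cos_pi_le1 b; lra.
Qed.

End cos_pi.

Section cone.
Context {R : realType} {d : nat} (Omega : domain R d).

(* Identifies (x, 0) with (y, 0) for all x and y. *)
Definition cone_rel (p q : Omega * {nonneg R}) : bool :=
  (p == q) || ((p.2%:num == 0) && (q.2%:num == 0)).

Lemma cone_rel_refl : reflexive cone_rel.
Proof. by move=> p; rewrite /cone_rel eqxx. Qed.

Lemma cone_rel_sym : symmetric cone_rel.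
Proof. by move=> p q; rewrite /cone_rel eq_sym andbC. Qed.

Lemma cone_rel_trans : transitive cone_rel.
Proof.
move=> q p s; rewrite /cone_rel => /orP[/eqP->//|/andP[p0 q0]].
by move=> /orP[/eqP<-|/andP[_ s0]]; rewrite p0 ?q0 ?s0 orbT.
Qed.

Canonical cone_equiv :=
  EquivRel cone_rel cone_rel_refl cone_rel_sym cone_rel_trans.

Definition cone : Type := {eq_quot cone_equiv}.

HB.instance Definition _ := Choice.on cone.

Definition cone_pt (x : Omega) (r : {nonneg R}) : cone :=
  \pi_{eq_quot cone_equiv} (x, r).

(* At the tip, [cone_base] is an arbitrary point of Omega. *)
Definition cone_base (z : cone) : Omega := (repr (z : {eq_quot cone_equiv})).1.

Definition cone_radius (z : cone) : R :=
  (repr (z : {eq_quot cone_equiv})).2%:num.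

Lemma cone_radius_ge0 z : 0 <= cone_radius z.
Proof. by rewrite /cone_radius. Qed.

Definition cone_dist (z w : cone) : R :=
  Num.sqrt (cone_radius z ^+ 2 + cone_radius w ^+ 2
    - 2 * cone_radius z * cone_radius w
      * cos_pi (eucl_dist (cone_base z) (cone_base w))).

Lemma cone_ptP (x y : Omega) (r s : {nonneg R}) :
  cone_pt x r = cone_pt y s <-> (x, r) = (y, s) \/ (r%:num = 0 /\ s%:num = 0).
Proof.
split=> [/eqP|h].
  rewrite /cone_pt eqmodE /= /cone_rel => /orP[/eqP->|/andP[/eqP r0 /eqP s0]].
    by left.
  by right.
apply/eqP; rewrite /cone_pt eqmodE /= /cone_rel.
by case: h => [->|[/= -> ->]]; rewrite ?eqxx ?orbT.
Qed.

Lemma cone_ptK (z : cone) :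
  cone_pt (cone_base z) (NngNum (cone_radius_ge0 z)) = z.
Proof.
rewrite /cone_pt /cone_base /cone_radius; set p := repr _.
have -> : (p.1, NngNum (cone_radius_ge0 z)) = p.
  by rewrite [RHS]surjective_pairing; congr pair; apply/val_inj.
exact: reprK.
Qed.

Lemma cone_radius_pt (x : Omega) (r : {nonneg R}) :
  cone_radius (cone_pt x r) = r%:num.
Proof.
have := cone_ptK (cone_pt x r) => /cone_ptP /=.
case=> [/(congr1 (fun p => p.2%:num))//|[r0 r0']].
by rewrite r0' -[RHS]r0.
Qed.

Lemma cone_base_pt (x : Omega) (r : {nonneg R}) :
  r%:num != 0 -> cone_base (cone_pt x r) = x.
Proof.
move=> r0; have := cone_ptK (cone_pt x r).
by move=> /cone_ptP[[]//|[_ /eqP]]; rewrite (negbTE r0).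
Qed.

Lemma cone_dist_pt (x y : Omega) (r s : {nonneg R}) :
  cone_dist (cone_pt x r) (cone_pt y s) =
  Num.sqrt (r%:num ^+ 2 + s%:num ^+ 2
            - 2 * r%:num * s%:num * cos_pi (eucl_dist x y)).
Proof.
rewrite /cone_dist !cone_radius_pt; congr (Num.sqrt (_ - _)).
have [->|r0] := eqVneq r%:num 0; first by rewrite mulr0 !mul0r.
have [->|s0] := eqVneq s%:num 0; first by rewrite mulr0 !mul0r.
by rewrite !cone_base_pt.
Qed.

Lemma cone_distxx z : cone_dist z z = 0.
Proof.
rewrite /cone_dist eucl_distxx cos_pi0 (_ : _ - _ = 0) ?sqrtr0//; ring.
Qed.

Lemma cone_dist_sym z w : cone_dist z w = cone_dist w z.
Proof. by rewrite /cone_dist eucl_dist_sym; congr Num.sqrt; ring. Qed.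

Lemma cone_dist_triangle y z w :
  cone_dist z w <= cone_dist z y + cone_dist y w.
Proof.
apply: cone_triangle; rewrite ?cone_radius_ge0 ?eucl_dist_ge0//.
exact: eucl_dist_triangle.
Qed.

Lemma cone_dist_eq0 z w : cone_dist z w = 0 -> z = w.
Proof.
move=> /eqP; rewrite sqrtr_eq0.
have rz := cone_radius_ge0 z; have rw := cone_radius_ge0 w.
have c1 := cos_pi_le1 (eucl_dist (cone_base z) (cone_base w)).
set c := cos_pi _ in c1 *.
rewrite (_ : _ - _ = (cone_radius z - cone_radius w) ^+ 2
    + 2 * (cone_radius z * cone_radius w * (1 - c))); last by ring.
have h1 := sqr_ge0 (cone_radius z - cone_radius w).
have h2 : 0 <= cone_radius z * cone_radius w * (1 - c).
  by rewrite !mulr_ge0// subr_ge0.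
move=> h; have /eqP : (cone_radius z - cone_radius w) ^+ 2 = 0 by lra.
rewrite sqrf_eq0 subr_eq0 => /eqP zw.
have : cone_radius z * cone_radius w * (1 - c) = 0 by lra.
rewrite {1}zw => /eqP m.
rewrite -[z in LHS]cone_ptK -[w in RHS]cone_ptK; apply/cone_ptP => /=.
move: m; rewrite !mulf_eq0 orbb => /orP[/eqP w0|]; first by right; rewrite zw.
rewrite subr_eq0 => /eqP/esym/(cos_pi_eq1 (eucl_dist_ge0 _ _))/eucl_dist_eq0 bzw.
by left; congr pair => //; apply/val_inj.
Qed.

HB.instance Definition _ := isMetric.Build R cone
  cone_distxx cone_dist_eq0 cone_dist_sym cone_dist_triangle.

HB.instance Definition _ := isPointed.Build cone (cone_pt point 0%:nng).

HB.instance Definition _ :=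
  Measurable.copy cone (g_sigma_algebraType (@open cone)).

End cone.

Section hellinger_kantorovich.
Context {R : realType} {d : nat} (Omega : domain R d).

Local Notation C := (cone Omega).
Local Notation M := {finite_measure set Omega -> \bar R}.
Local Notation MC := {finite_measure set C -> \bar R}.

Implicit Types (mu : M) (lam : MC) (gam : {measure set (C * C) -> \bar R}).

Local Open Scope ereal_scope.

(* [mu] is the projection of [lam], a set function so that it can be a
   [pushforward]. *)
Definition is_projection (lam : set C -> \bar R) mu : Prop :=
  forall phi : Omega -> R, continuous phi ->
    \int[mu]_x (phi x)%:E =
    \int[lam]_z (cone_radius z ^+ 2 * phi (cone_base z))%:E.

Definition finite_second_moment lam : Prop :=
  \int[lam]_z (cone_radius z ^+ 2)%:E < +oo.

Definition is_lift mu lam : Prop :=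
  finite_second_moment lam /\ is_projection lam mu.

(* The product sigma-algebra on [C * C] is the Borel one, as [C] is
   separable. *)
Definition is_plan lam0 lam1 gam : Prop :=
  forall A : set C, measurable A ->
    pushforward gam fst A = lam0 A /\ pushforward gam snd A = lam1 A.

Definition transport_cost gam : \bar R :=
  \int[gam]_z (mdist z.1 z.2 ^+ 2)%:E.

(* Equal to +oo if there is no plan. *)
Definition cone_wasserstein lam0 lam1 : \bar R :=
  sqrte (ereal_inf [set transport_cost gam | gam in is_plan lam0 lam1]).

Definition HK mu0 mu1 : \bar R :=
  ereal_inf [set cone_wasserstein l.1 l.2 |
    l in [set l : MC * MC | is_lift mu0 l.1 /\ is_lift mu1 l.2]].

Definition optimal_plan lam0 lam1 gam : Prop :=
  is_plan lam0 lam1 gam /\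
  transport_cost gam = cone_wasserstein lam0 lam1 ^+ 2.

Definition optimal_lifts mu0 mu1 lam0 lam1 : Prop :=
  [/\ is_lift mu0 lam0, is_lift mu1 lam1 &
      cone_wasserstein lam0 lam1 = HK mu0 mu1].

End hellinger_kantorovich.

(* Constant-speed minimal geodesic from [z0] to [z1], parametrized by [0, 1];
   the values of [c] outside [0, 1] are irrelevant. *)
Definition minimal_geodesic {R : realType} {T : metricType R}
    (z0 z1 : T) (c : R -> T) : Prop :=
  [/\ c 0 = z0, c 1 = z1 &
      forall s t, s \in `[0, 1] -> t \in `[0, 1] ->
        mdist (c s) (c t) = `|s - t| * mdist z0 z1].

(* [g] is the derivative of [f] on [A], one-sided at the endpoints when [A] is
   an interval. *)
Definition derivative_on {R : realType} (A : set R) (f g : R -> R) : Prop :=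
  forall s, A s ->
    (f t - f s) / (t - s) @[t --> within A s^'] --> g s.

(* Main.v *)
(* Put T^2 = (1-s)^2 r0^2 + s^2 r1^2 + 2 s (1-s) r0 r1 cos_pi|x0 - x1|.
   Expanding the squared distances from a geodesic point [y, t] to z0 and z1
   gives t^2 + T^2 = 2 t K with
   K = (1-s) r0 cos_pi|x0 - y| + s r1 cos_pi|y - x1|, and the triangle
   inequality for y yields K <= T; hence t = T.  Equality K = T moreover
   determines y when T > 0, so that Z(s; z0, z1) is an explicit Borel function
   of (z0, z1), whatever selection Z of minimal geodesics is given.  Integrating
   T^2 against gamma gives the formula for m(s), and integrating dist^2 gives
   HK^2 = m(0) + m(1) - 2 m_*.

   The bound m_* >= 0 is equivalent to HK^2 <= m(0) + m(1), which is the cost of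
   transporting everything through the tip: adding mass at the tip to the
   lifts does not change their projections.  The bound
   m_* <= sqrt(m(0) m(1)) is the Cauchy-Schwarz inequality. *)
From HB Require Import structures.
Require Import Defs.
From mathcomp Require Import all_boot all_order all_algebra.
From mathcomp Require Import all_classical all_reals all_analysis.
From mathcomp Require Import measurable_realfun ring lra.

Set Implicit Arguments.
Unset Strict Implicit.
Unset Printing Implicit Defensive.

Import Order.TTheory GRing.Theory Num.Theory.
Import numFieldTopology.Exports numFieldNormedType.Exports.

Local Open Scope classical_set_scope.
Local Open Scope ring_scope.

(** * Angles seen from the tip *)

Section cone_angles.
Context {R : realType}.
Implicit Types al be a b c T : R.

Lemma cos_pi_small a : a <= pi -> cos_pi a = cos a.
Proof. by move=> ap; rewrite /cos_pi min_l. Qed.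

(** Since [b] exceeds [pi - a] and [cos_pi] is antitone, [cos_pi b] is at most
    [cos (pi - a) = - cos a]; for [a > pi] the first term is already -1. *)
Lemma cos_pi_obtuse a b : 0 <= a -> 0 <= b -> pi < a + b ->
  cos_pi a + cos_pi b <= 0.
Proof.
move=> a0 b0 abp; have p0 := pi_gt0 R; have [ap|ap] := leP a pi.
  have : cos_pi b <= cos_pi (pi - a) by apply: le_cos_pi; lra.
  rewrite (cos_pi_small ap) (@cos_pi_small (pi - a)); last by lra.
  by rewrite (addrC pi) cosDpi cosN; lra.
rewrite {1}/cos_pi (min_r (ltW ap)) cospi.
by have := cos_pi_le1 b; lra.
Qed.

Lemma cos_pi_concat a b c : a + b <= pi -> 0 <= c -> c <= a + b ->
  cos a * cos b - sin a * sin b <= cos_pi c.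
Proof.
move=> abp c0 cab; rewrite -cosD -cos_pi_small//.
exact: le_cos_pi.
Qed.

(** The gap T^2 - K^2 splits into the defect of the triangle inequality for the angles and a square.
    Nonnegativity of both gives the inequality K <= T, and their simultaneous vanishing gives its
    equality case. *)
Let sqr_defect al be a b c :
  al ^+ 2 + be ^+ 2 + 2 * al * be * c - (al * cos a + be * cos b) ^+ 2 =
  2 * (al * be) * (c - (cos a * cos b - sin a * sin b))
  + (al * sin a - be * sin b) ^+ 2.
Proof.
have e1 := cos2Dsin2 a; have e2 := cos2Dsin2 b.
transitivity (al ^+ 2 * (cos a ^+ 2 + sin a ^+ 2) +
  be ^+ 2 * (cos b ^+ 2 + sin b ^+ 2) + 2 * al * be * c -
  (al * cos a + be * cos b) ^+ 2); first by rewrite e1 e2; ring.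
by ring.
Qed.

(** If a + b <= pi, [sqr_defect] writes T^2 - K^2 as a sum of nonnegative terms. Otherwise
    [cos_pi a + cos_pi b <= 0], so that K is at most |al - be|, which is at most T. *)
Lemma cone_angle_le al be a b c T : 0 <= al -> 0 <= be ->
    0 <= a -> 0 <= b -> 0 <= c -> c <= a + b -> 0 <= T ->
    T ^+ 2 = al ^+ 2 + be ^+ 2 + 2 * al * be * cos_pi c ->
  al * cos_pi a + be * cos_pi b <= T.
Proof.
move=> al0 be0 a0 b0 c0 cab T0 TE.
have ab0 : 0 <= al * be by rewrite mulr_ge0.
have [abp|abp] := leP (a + b) pi.
  rewrite !cos_pi_small; [|lra..].
  have h := cos_pi_concat abp c0 cab; have := sqr_defect al be a b (cos_pi c).
  rewrite -TE => e; apply: le_trans (ler_norm _) _.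
  rewrite -(@ler_pXn2r _ 2)// ?nnegrE// real_normK ?num_real//.
  rewrite -subr_ge0 e addr_ge0 ?sqr_ge0// !mulr_ge0//; lra.
have s0 := cos_pi_obtuse a0 b0 abp.
have h : `|al - be| <= T.
  rewrite -(@ler_pXn2r _ 2)// ?nnegrE// real_normK ?num_real// TE.
  rewrite -subr_ge0 (_ : _ - _ = 2 * (al * be) * (1 + cos_pi c)); last by ring.
  by rewrite !mulr_ge0//; have := cos_pi_ge0 c; lra.
have [ba|ba] := leP be al.
- have h1 : be * (cos_pi a + cos_pi b) <= 0 by rewrite mulr_ge0_le0.
  have h2 : (al - be) * (1 - cos_pi a) >= 0.
    by rewrite mulr_ge0//; have := cos_pi_le1 a; lra.
  by have := ler_norm (al - be); lra.
- have h1 : al * (cos_pi a + cos_pi b) <= 0 by rewrite mulr_ge0_le0.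
  have h2 : (be - al) * (1 - cos_pi b) >= 0.
    by rewrite mulr_ge0//; have := cos_pi_le1 b; lra.
  by have := ler_norm (be - al); rewrite distrC; lra.
Qed.

(** Equality case of [cone_angle_le]. The first conclusion determines the angle [a] from the
    endpoints; the second one places the middle base point at an end or, by additivity of the
    distances, on the segment between them. *)
Lemma cone_angle_eq al be a b c T : 0 <= al -> 0 <= be ->
    0 <= a -> 0 <= b -> 0 <= c ->
    c <= a + b -> a <= c + b -> b <= c + a -> 0 < T ->
    T ^+ 2 = al ^+ 2 + be ^+ 2 + 2 * al * be * cos_pi c ->
    al * cos_pi a + be * cos_pi b = T ->
  cos_pi a * T = al + be * cos_pi c /\
  [\/ a = 0, b = 0 | c = a + b /\ c <= pi].
Proof.
move=> al0 be0 a0 b0 c0 cab acb bca T0 TE KE.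
have sqrI (x : R) : 0 <= x -> T ^+ 2 = x ^+ 2 -> T = x.
  by move=> x0 /eqP; rewrite eqrXn2 ?(ltW T0)// => /eqP.
have [alE|aln] := eqVneq al 0.
  have TB : T = be by apply: sqrI => //; rewrite TE alE; ring.
  have bE : b = 0.
    apply: cos_pi_eq1 => //; apply: (mulfI (lt0r_neq0 T0)).
    by rewrite mulr1 -[RHS]KE alE TB; ring.
  have -> : a = c by lra.
  by split; [rewrite alE TB; ring | constructor 2].
have [beE|ben] := eqVneq be 0.
  have TA : T = al by apply: sqrI => //; rewrite TE beE; ring.
  have aE : a = 0.
    apply: cos_pi_eq1 => //; apply: (mulfI (lt0r_neq0 T0)).
    by rewrite mulr1 -[RHS]KE beE TA; ring.
  split; last by constructor 1.
  by rewrite beE aE cos_pi0 TA; ring.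
have alp : 0 < al by rewrite lt_def aln.
have bep : 0 < be by rewrite lt_def ben.
have ab0 : 0 < al * be by rewrite mulr_gt0.
have [abp|abp] := leP (a + b) pi.
  have h := cos_pi_concat abp c0 cab.
  have ap : a <= pi by lra.
  have bp : b <= pi by lra.
  have cp : c <= pi by lra.
  rewrite !cos_pi_small// in KE TE h *.
  have := sqr_defect al be a b (cos c).
  rewrite -TE -KE subrr => e.
  have q0 := sqr_ge0 (al * sin a - be * sin b).
  have p0 : 0 <= (al * be) * (cos c - (cos a * cos b - sin a * sin b)).
    by rewrite mulr_ge0 ?subr_ge0 ?(ltW ab0).
  have cE : cos c = cos a * cos b - sin a * sin b.
    apply/eqP; rewrite -subr_eq0; apply/eqP; apply: (mulfI (lt0r_neq0 ab0)).
    by rewrite mulr0; lra.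
  have sE : al * sin a = be * sin b.
    apply/eqP; rewrite -subr_eq0 -sqrf_eq0; apply/eqP.
    by rewrite cE in e; lra.
  split.
    transitivity (al * (cos a ^+ 2 + sin a ^+ 2) - sin a * (al * sin a)
      + be * cos a * cos b); first by ring.
    by rewrite cos2Dsin2 sE cE; ring.
  constructor 3; split=> //.
  move: cE; rewrite -cosD.
  by move/cos_inj; apply; rewrite in_itv/=; apply/andP; split; lra.
have s0 := cos_pi_obtuse a0 b0 abp.
(* From here on a + b > pi, where equality forces T = |al - be| and hence opposite directions. *)
have cE x : T = x -> x ^+ 2 = (al - be) ^+ 2 -> cos_pi c = -1.
  move=> <- e; apply: (mulfI (lt0r_neq0 ab0)). lra.
have Tge : (al - be) ^+ 2 <= T ^+ 2.
  rewrite TE -subr_ge0 (_ : _ - _ = 2 * (al * be) * (1 + cos_pi c)); last by ring.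
  by rewrite !mulr_ge0 ?(ltW alp) ?(ltW bep)//; have := cos_pi_ge0 c; lra.
have absT x : x ^+ 2 = (al - be) ^+ 2 -> x <= T.
  move=> e; apply: le_trans (ler_norm x) _.
  by rewrite -(@ler_pXn2r _ 2)// ?nnegrE ?(ltW T0)// real_normK ?num_real// e.
(* The distance attached to the larger weight must vanish; equal weights would give T <= 0. *)
have [h|h|h] := ltgtP al be.
- have h1 : al * (cos_pi a + cos_pi b) <= 0 by rewrite mulr_ge0_le0.
  have h2 : (be - al) * (1 - cos_pi b) >= 0.
    by rewrite mulr_ge0//; have := cos_pi_le1 b; lra.
  have h3 : be - al <= T by apply: absT; ring.
  have bE : b = 0.
    apply: cos_pi_eq1 => //; apply: (@mulfI _ (be - al)); last by lra.
    by rewrite subr_eq0 gt_eqF.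
  have TB : T = be - al by lra.
  have {}cE : cos_pi c = -1 by apply: cE TB _; ring.
  have -> : a = c by lra.
  by split; [rewrite cE TB; ring | constructor 2].
- have h1 : be * (cos_pi a + cos_pi b) <= 0 by rewrite mulr_ge0_le0.
  have h2 : (al - be) * (1 - cos_pi a) >= 0.
    by rewrite mulr_ge0//; have := cos_pi_le1 a; lra.
  have h3 : al - be <= T by apply: absT; ring.
  have aE : a = 0.
    apply: cos_pi_eq1 => //; apply: (@mulfI _ (al - be)); last by lra.
    by rewrite subr_eq0 gt_eqF.
  have TB : T = al - be by lra.
  have {}cE : cos_pi c = -1 by apply: cE TB _; ring.
  by split; [rewrite cE TB aE cos_pi0; ring | constructor 1].
- exfalso; have : be * (cos_pi a + cos_pi b) <= 0 by rewrite mulr_ge0_le0.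
  by rewrite h in KE; lra.
Qed.

End cone_angles.

(** * Real-valued measurable functions *)

Section measurable_real.
Context {R : realType} {dT : measure_display} {T : measurableType dT}.
Implicit Types f g : T -> R.

Lemma measurable_fun_gt f :
  (forall q, measurable [set t | q < f t]) -> measurable_fun setT f.
Proof.
move=> h _; apply: (measurability _ (RGenOInfty.measurableE R)) => //.
by move=> /= _ [_ [q ->] <-]; rewrite setTI preimage_itvoy.
Qed.

Lemma measurable_fun_sqrt f :
  measurable_fun setT f -> measurable_fun setT (fun t => Num.sqrt (f t)).
Proof.
apply: measurableT_comp; apply: nondecreasing_measurable => // x y.
exact: ler_wsqrtr.
Qed.

(** On nonnegative reals, 0 included, the inverse is the real power of exponent -1, and [powR] is
    measurable. *)
Lemma measurable_fun_inv_ge0 f : (forall t, 0 <= f t) ->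
  measurable_fun setT f -> measurable_fun setT (fun t => (f t)^-1).
Proof.
move=> f0 mf; under eq_fun do rewrite -powR_inv1//.
exact: measurableT_comp (measurable_powR _) mf.
Qed.

Lemma measurable_fun_div_ge0 f g : (forall t, 0 <= g t) ->
  measurable_fun setT f -> measurable_fun setT g ->
  measurable_fun setT (fun t => f t / g t).
Proof.
by move=> g0 mf mg; apply: measurable_funM => //; exact: measurable_fun_inv_ge0.
Qed.

Lemma measurable_fun_cos_pi f :
  measurable_fun setT f -> measurable_fun setT (fun t => cos_pi (f t)).
Proof.
move=> mf; have mcos : measurable_fun setT (@cos R).
  exact: continuous_measurable_fun (@continuous_cos R).
by apply: measurableT_comp mcos _; exact: measurable_minr.
Qed.

Lemma measurable_bigcup_countType (I : countType) (F : I -> set T) :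
  (forall i, measurable (F i)) -> measurable (\bigcup_i F i).
Proof.
move=> mF; rewrite (_ : \bigcup_i F i =
    \bigcup_n (if unpickle n is Some i then F i else set0)).
  by apply: bigcup_measurable => n _; case: unpickle.
apply/seteqP; split=> [t [i _ Fi]|t [n _]].
  by exists (pickle i); rewrite ?pickleK.
by case: unpickle => // i Fi; exists i.
Qed.

End measurable_real.

(* Truncating the argument to [-1, 1] makes this function antitone. *)
Definition acos_trunc {R : realType} (x : R) : R :=
  acos (Num.max (-1) (Num.min 1 x)).

Section acos_trunc.
Context {R : realType}.
Implicit Types x : R.

Lemma acos_truncE x : -1 <= x <= 1 -> acos_trunc x = acos x.
Proof. by move=> /andP[x1 x2]; rewrite /acos_trunc min_r// max_r. Qed.

Let trunc_itv x : -1 <= Num.max (-1) (Num.min 1 x) <= 1.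
Proof. by rewrite le_max lexx/= ge_max ge_min lexx/= andbT; lra. Qed.

Lemma measurable_acos_trunc : measurable_fun setT (@acos_trunc R).
Proof.
apply: nonincreasing_measurable => // x y xy; rewrite leNgt -ltr_cos.
- rewrite !acosK ?in_itv/= ?trunc_itv// -leNgt ge_max !le_max lexx/=.
  by rewrite le_min !ge_min lexx/= xy !orbT.
- by rewrite in_itv/= acos_ge0 ?acos_lepi ?trunc_itv.
- by rewrite in_itv/= acos_ge0 ?acos_lepi ?trunc_itv.
Qed.

End acos_trunc.

(** * Geodesic points *)

Section cone_geodesics.
Context {R : realType} {d : nat} (Omega : domain R d).
Implicit Types (x y : Omega) (z w p : cone Omega) (s : R).

(** Strict convexity of the Euclidean norm: equality in the triangle inequality puts [y] on the
    segment. *)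
Lemma eucl_dist_between x y x' (i : 'I_d) :
  eucl_dist x x' = eucl_dist x y + eucl_dist y x' ->
  pt_coord y 0 i = pt_coord x 0 i
    + eucl_dist x y / eucl_dist x x' * (pt_coord x' 0 i - pt_coord x 0 i).
Proof.
have a0 := eucl_dist_ge0 x y; have b0 := eucl_dist_ge0 y x'.
have [c0|c0] := eqVneq (eucl_dist x x') 0.
  rewrite c0 => ab; have /eucl_dist_eq0 <- : eucl_dist x y = 0 by lra.
  by rewrite eucl_distxx mul0r mul0r addr0.
set t := _ / _ => cE.
have aE : eucl_dist x y = t * eucl_dist x x' by rewrite /t mulfVK.
have bE : eucl_dist y x' = (1 - t) * eucl_dist x x' by lra.
pose v := pt_coord y - pt_coord x - t *: (pt_coord x' - pt_coord x).
(* Stewart's identity; its right-hand side vanishes once both partial distances are expressed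
   through [t]. *)
have : enorm v ^+ 2 = (1 - t) * eucl_dist x y ^+ 2 + t * eucl_dist y x' ^+ 2
    - t * (1 - t) * eucl_dist x x' ^+ 2.
  rewrite /eucl_dist !sqr_enorm !mulr_sumr -big_split -sumrB.
  by apply: eq_bigr => j _; rewrite !mxE /=; ring.
rewrite aE bE (_ : _ - _ = 0); last by ring.
move/eqP; rewrite sqrf_eq0 => /eqP/enorm_eq0/rowP/(_ i).
by rewrite !mxE => h; lra.
Qed.

(** The length T of the law of cosines, grouped by the weights (1-s) r0 and s r1, which play the
    roles of [al] and [be] in the angle lemmas. *)
Definition geo_radius s z w : R :=
  Num.sqrt (((1 - s) * cone_radius z) ^+ 2 + (s * cone_radius w) ^+ 2
    + 2 * ((1 - s) * cone_radius z) * (s * cone_radius w)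
      * cos_pi (eucl_dist (cone_base z) (cone_base w))).

(* The angle, measured at the tip, between [z] and the point of parameter [s]
   on the geodesic from [z] to [w]. *)
Definition geo_angle s z w : R :=
  acos_trunc (((1 - s) * cone_radius z + s * cone_radius w
      * cos_pi (eucl_dist (cone_base z) (cone_base w))) / geo_radius s z w).

(** The radicand is (r - r')^2 + 2 r r' (1 - cos_pi), hence nonnegative, and the root can be
    undone. *)
Lemma sqr_cone_dist z w : cone_dist z w ^+ 2 =
  cone_radius z ^+ 2 + cone_radius w ^+ 2 - 2 * cone_radius z * cone_radius w
    * cos_pi (eucl_dist (cone_base z) (cone_base w)).
Proof.
rewrite sqr_sqrtr//; have := cos_pi_le1 (eucl_dist (cone_base z) (cone_base w)).
move: (cos_pi _) => c c1; rewrite (_ : _ - _ = (cone_radius z - cone_radius w) ^+ 2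
    + 2 * (cone_radius z * cone_radius w) * (1 - c)); last by ring.
by rewrite addr_ge0 ?sqr_ge0// !mulr_ge0 ?cone_radius_ge0 ?subr_ge0.
Qed.

Lemma sqr_geo_radius s z w : 0 <= s <= 1 -> geo_radius s z w ^+ 2 =
  ((1 - s) * cone_radius z) ^+ 2 + (s * cone_radius w) ^+ 2
    + 2 * ((1 - s) * cone_radius z) * (s * cone_radius w)
      * cos_pi (eucl_dist (cone_base z) (cone_base w)).
Proof.
move=> /andP[s0 s1]; rewrite sqr_sqrtr//.
have := cos_pi_ge0 (eucl_dist (cone_base z) (cone_base w)).
move: (cos_pi _) => c c1.
rewrite (_ : _ + _ = ((1 - s) * cone_radius z - s * cone_radius w) ^+ 2
    + 2 * (((1 - s) * cone_radius z) * (s * cone_radius w)) * (1 + c));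
  last by ring.
by rewrite addr_ge0 ?sqr_ge0// !mulr_ge0 ?cone_radius_ge0 ?subr_ge0//; lra.
Qed.

(* Expanding the two distances reduces the claim on the radius to
   [(r - T) ^+ 2 <= 0], where [r] is the radius of [p] and
   [T = geo_radius s z w]. *)
Lemma cone_geodesic_point s z w p : 0 < s < 1 ->
  cone_dist z p = s * cone_dist z w ->
  cone_dist p w = (1 - s) * cone_dist z w ->
  cone_radius p = geo_radius s z w /\
  (geo_radius s z w != 0 -> forall i : 'I_d,
    pt_coord (cone_base p) 0 i = pt_coord (cone_base z) 0 i
      + geo_angle s z w
        / Num.min (eucl_dist (cone_base z) (cone_base w)) pi
        * (pt_coord (cone_base w) 0 i - pt_coord (cone_base z) 0 i)).
Proof.
move=> /andP[s0 s1] zp pw.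
have s01 : 0 <= s <= 1 by rewrite !ltW.
have TE := sqr_geo_radius z w s01.
have T0 : 0 <= geo_radius s z w by exact: sqrtr_ge0.
have r0 := cone_radius_ge0 z; have r1 := cone_radius_ge0 w.
have t0 := cone_radius_ge0 p.
have := sqr_cone_dist p w; rewrite pw exprMn sqr_cone_dist.
have := sqr_cone_dist z p; rewrite zp exprMn sqr_cone_dist.
have a0 := eucl_dist_ge0 (cone_base z) (cone_base p).
have b0 := eucl_dist_ge0 (cone_base p) (cone_base w).
have c0 := eucl_dist_ge0 (cone_base z) (cone_base w).
have cab := eucl_dist_triangle (cone_base p) (cone_base z) (cone_base w).
have acb := eucl_dist_triangle (cone_base w) (cone_base z) (cone_base p).
have bca := eucl_dist_triangle (cone_base z) (cone_base p) (cone_base w).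
rewrite (eucl_dist_sym (cone_base w)) in acb.
rewrite (eucl_dist_sym _ (cone_base z)) addrC in bca.
move: cab acb bca (@eucl_dist_between (cone_base z) (cone_base p) (cone_base w)).
rewrite /geo_angle; move: TE T0 a0 b0 c0.
set a := eucl_dist _ (cone_base p); set b := eucl_dist (cone_base p) _.
set c := eucl_dist (cone_base z) _.
move: (geo_radius s z w) => T TE T0 a0 b0 c0 cab acb bca between e0 e1.
set t := cone_radius p in t0 e0 e1 *.
set K : R := (1 - s) * cone_radius z * cos_pi a + s * cone_radius w * cos_pi b.
have al0 : 0 <= (1 - s) * cone_radius z by rewrite mulr_ge0//; lra.
have be0 : 0 <= s * cone_radius w by rewrite mulr_ge0//; lra.
have KT : K <= T by exact: cone_angle_le TE.
(* Add the expansion of d(z,p)^2 times 1-s to that of d(p,w)^2 times s; the left-hand sides combine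
   to s(1-s) d(z,w)^2. *)
have e : t ^+ 2 + T ^+ 2 = 2 * t * K.
  rewrite TE /K; move: e0 e1.
  set r := cone_radius z; set r' := cone_radius w => e0 e1.
  have /(congr1 (fun u : R => (1 - s) * u)) := e0.
  have /(congr1 (fun u : R => s * u)) := e1.
  by lra.
have tKT : 0 <= t * (T - K) by rewrite mulr_ge0 ?subr_ge0.
have tT : t = T.
  apply/eqP; rewrite -subr_eq0 -sqrf_eq0 eq_le sqr_ge0 andbT.
  by rewrite sqrrB mulr2n; lra.
split=> // Tn i; have Tp : 0 < T by rewrite lt_def Tn.
have KE : K = T.
  by apply: (mulfI Tn); rewrite tT in e; lra.
have [aE cases] := cone_angle_eq al0 be0 a0 b0 c0 cab acb bca Tp TE KE.
(* By [cone_angle_eq] the argument of the arccosine is [cos_pi a]. *)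
have -> : acos_trunc (((1 - s) * cone_radius z + s * cone_radius w * cos_pi c) / T)
    = Num.min a pi.
  rewrite -aE mulfK// acos_truncE ?cos_pi_ge0 ?cos_pi_le1//.
  rewrite /cos_pi cosK// in_itv/= le_min a0 pi_ge0/=.
  by rewrite ge_min lexx orbT.
(* The coefficient of the displacement is 0 if a = 0, and 1 if b = 0 and c > 0, also beyond pi since
   both minima truncate alike; in the last case no truncation occurs. *)
case: cases => [a00|b00|[cE cp]].
- by rewrite a00 min_l ?pi_ge0// mul0r mul0r addr0 (eucl_dist_eq0 a00).
- have ac : a = c by lra.
  rewrite (eucl_dist_eq0 b00); have [c00|cn] := eqVneq c 0.
    by rewrite (eucl_dist_eq0 c00) subrr mulr0 addr0.
  rewrite ac.
  rewrite divff ?mul1r; first by rewrite addrC subrK.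
  by rewrite gt_eqF// lt_min pi_gt0 lt_def cn c0.
- by rewrite !min_l//; [exact: between | lra].
Qed.

End cone_geodesics.

(** * The Borel sets of the cone *)

Section cone_measurable.
Context {R : realType} {d : nat} {Omega : domain R d}.
Implicit Types (x y : Omega) (z w : cone Omega).

Definition cone_coord (i : 'I_d) z : R := pt_coord (cone_base z) 0 i.

Lemma measurable_cone_open (U : set (cone Omega)) :
  (forall z, U z -> exists2 e : R, 0 < e & forall w, cone_dist z w < e -> U w) ->
  measurable U.
Proof.
move=> h; apply: sub_sigma_algebra; rewrite openE => z /h[e e0 Ue].
apply/nbhs_ballP; exists e => // w; rewrite ballEmdist/=; exact: Ue.
Qed.

Lemma cone_open_dist (U : set (cone Omega)) z : open U -> U z ->
  exists2 e : R, 0 < e & forall w, cone_dist z w < e -> U w.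
Proof.
by rewrite openE => Uo /Uo /nbhs_ballP[e e0 Ue]; exists e.
Qed.

Lemma cone_radius_dist z w : `|cone_radius z - cone_radius w| <= cone_dist z w.
Proof.
rewrite -(@ler_pXn2r _ 2)// ?nnegrE ?sqrtr_ge0// real_normK ?num_real//.
rewrite sqr_cone_dist; have := cos_pi_le1 (eucl_dist (cone_base z) (cone_base w)).
move: (cos_pi _) => c c1; rewrite -subr_ge0.
rewrite (_ : _ - _ = 2 * (cone_radius z * cone_radius w) * (1 - c)); last by ring.
by rewrite !mulr_ge0 ?cone_radius_ge0 ?subr_ge0.
Qed.

Lemma measurable_cone_radius : measurable_fun setT (@cone_radius R d Omega).
Proof.
apply: measurable_fun_gt => q; apply: measurable_cone_open => z /= qz.
exists (cone_radius z - q); first by rewrite subr_gt0.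
by move=> w /(le_lt_trans (cone_radius_dist z w)); rewrite ltr_norml; lra.
Qed.

(** In the plane, r sin e is the distance from a point of radius r to the line through the tip at
    angle e. Small cone distance thus forces close base points away from the tip. *)
Lemma cone_dist_base_lb z w (e : R) : 0 <= e <= pi ->
  e <= eucl_dist (cone_base z) (cone_base w) ->
  cone_radius z * sin e <= cone_dist z w.
Proof.
move=> /andP[e0 epi] h; have := le_cos_pi e0 h; rewrite (cos_pi_small epi) => c.
have r0 := cone_radius_ge0 z; have r1 := cone_radius_ge0 w.
have s0 : 0 <= sin e by rewrite sin_ge0_pi// e0.
rewrite -(@ler_pXn2r _ 2)// ?nnegrE ?sqrtr_ge0 ?mulr_ge0// sqr_cone_dist.
rewrite -subr_ge0.
move: (cos_pi _) c => c ce.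
rewrite (_ : _ - _ = (cone_radius w - cone_radius z * cos e) ^+ 2
   + 2 * (cone_radius z * cone_radius w) * (cos e - c)
   + cone_radius z ^+ 2 * (1 - (cos e ^+ 2 + sin e ^+ 2))); last by ring.
rewrite cos2Dsin2 subrr mulr0 addr0.
by rewrite addr_ge0 ?sqr_ge0// !mulr_ge0// subr_ge0.
Qed.

Lemma coord_le_eucl_dist x y i :
  `|pt_coord x 0 i - pt_coord y 0 i| <= eucl_dist x y.
Proof.
rewrite -(@ler_pXn2r _ 2)// ?nnegrE ?sqrtr_ge0// real_normK ?num_real//.
rewrite sqr_enorm (bigD1 i)//= !mxE lerDl sumr_ge0// => j _.
exact: sqr_ge0.
Qed.

Lemma cone_radius0 z w : cone_radius z = 0 -> cone_radius w = 0 -> z = w.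
Proof.
move=> z0 w0; rewrite -[z]cone_ptK -[w]cone_ptK.
by apply/cone_ptP; right => /=; rewrite z0 w0.
Qed.

(* Away from the tip the base point depends continuously on [z]; on the tip it
   is constant. *)
Lemma measurable_cone_base (g : Omega -> R) :
  (forall x q, q < g x -> exists2 e : R, 0 < e &
     forall y, eucl_dist x y < e -> q < g y) ->
  measurable_fun setT (g \o @cone_base R d Omega).
Proof.
move=> gcont; apply: measurable_fun_gt => q; rewrite (_ : [set z | _] =
    [set z | cone_radius z = 0 /\ q < g (cone_base z)]
    `|` [set z | 0 < cone_radius z /\ q < g (cone_base z)]); last first.
  apply/seteqP; split=> z /=; last by move=> [[]|[]].
  move=> qz; have := cone_radius_ge0 z; rewrite le_eqVlt => /orP[/eqP r0|r0].
    by left.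
  by right.
apply: measurableU.
- have mr0 : measurable [set z : cone Omega | cone_radius z = 0].
    have := @measurable_cone_radius measurableT [set 0] (measurable_set1 0).
    by rewrite setTI.
  (* All points of radius zero coincide, so this part is either empty or the whole tip. *)
  have [[z [z0 qz]]|n] := pselect
      (exists z : cone Omega, cone_radius z = 0 /\ q < g (cone_base z)); last first.
    rewrite (_ : [set z | _] = set0) ?measurable0//.
    by apply/seteqP; split=> // z hz; apply: n; exists z.
  rewrite (_ : [set z | _] = [set z : cone Omega | cone_radius z = 0])//.
  apply/seteqP; split=> [w []//|w /= w0].
  by rewrite -(cone_radius0 z0 w0).
- apply: measurable_cone_open => z /= [z0 /gcont[e1 e10 e1g]].
  (* The cap [pi / 2] keeps [e] below [pi], so that [sin e > 0]. *)
  pose e := Num.min (pi / 2) e1.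
  have pi0 := pi_gt0 R.
  have e0 : 0 < e by rewrite lt_min e10; lra.
  have epi : e < pi by rewrite gt_min; apply/orP; left; lra.
  have se : 0 < sin e by rewrite sin_gt0_pi// e0.
  (* The first bound keeps the radius of [w] positive, the second keeps its base point within
     [e]. *)
  exists (Num.min (cone_radius z) (cone_radius z * sin e)).
    by rewrite lt_min z0 mulr_gt0.
  move=> w; rewrite lt_min => /andP[w1 w2]; split.
    by have := le_lt_trans (cone_radius_dist z w) w1; rewrite ltr_norml; lra.
  apply: e1g; have : eucl_dist (cone_base z) (cone_base w) < e.
    have ee : 0 <= e <= pi by rewrite !ltW.
    by rewrite ltNge; apply/negP => /(cone_dist_base_lb ee); rewrite leNgt w2.
  by rewrite lt_min => /andP[].
Qed.

Lemma measurable_cone_coord i : measurable_fun setT (cone_coord i).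
Proof.
apply: (@measurable_cone_base (fun x => pt_coord x 0 i)) => x q qx.
exists (pt_coord x 0 i - q) => [|y]; first by rewrite subr_gt0.
by move=> /(le_lt_trans (coord_le_eucl_dist x y i)); rewrite ltr_norml; lra.
Qed.

(** The topology comes from sup-norm balls, and the Euclidean norm dominates the sup norm. *)
Lemma nbhs_eucl_dist x (U : set Omega) : nbhs x U ->
  exists2 e : R, 0 < e & forall y, eucl_dist x y < e -> U y.
Proof.
rewrite nbhsE => -[V [[W Wo WV] Vx] VU].
move: Wo; rewrite openE => /(_ (pt_coord x)).
have Wx : W (pt_coord x) by rewrite -WV in Vx.
move=> /(_ Wx) /nbhs_ballP[e /= e0 eW]; exists e => // y xy.
apply/VU; rewrite -WV; apply: eW; split=> // a b.
rewrite -ball_normE/= (ord1 a); apply: le_lt_trans xy.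
exact: coord_le_eucl_dist.
Qed.

Lemma measurable_continuous_cone_base (phi : Omega -> R) : continuous phi ->
  measurable_fun setT (phi \o @cone_base R d Omega).
Proof.
move=> cphi; apply: measurable_cone_base => x q qx.
have : nbhs (phi x) [set r | q < r].
  by apply: open_nbhs_nbhs; split=> //; exact: open_gt.
by move=> /cphi/nbhs_eucl_dist.
Qed.

(** The constant is a crude substitute for sqrt d; the successor keeps it positive even for d = 0,
    so that one may divide by it. *)
Lemma eucl_dist_le_coord x y (e : R) :
  (forall i : 'I_d, `|pt_coord x 0 i - pt_coord y 0 i| <= e) -> 0 <= e ->
  eucl_dist x y <= d.+1%:R * e.
Proof.
move=> h e0; rewrite -(@ler_pXn2r _ 2)// ?nnegrE ?sqrtr_ge0 ?mulr_ge0//.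
rewrite sqr_enorm (@le_trans _ _ (\sum_(i < d) e ^+ 2))//.
  apply: ler_sum => i _; rewrite !mxE -[leLHS]real_normK ?num_real//.
  by rewrite ler_pXn2r ?nnegrE.
rewrite sumr_const card_ord -[leLHS]mulr_natl exprMn ler_wpM2r ?sqr_ge0//.
by rewrite -natrX ler_nat expnS expn1 mulSn (leq_trans (leqnSn d))// leq_addr.
Qed.

(** Writing d^2 = (r-s)^2 + 2 r s (1 - cos_pi), the radial term is at most e^2/4 and the angular one
    at most e^2/2. *)
Lemma cone_dist_small z (e : R) : 0 < e -> exists2 k : R, 0 < k &
  forall w, (forall i, `|cone_coord i z - cone_coord i w| < k) ->
    `|cone_radius z - cone_radius w| < k -> cone_dist z w < e.
Proof.
move=> e0; set r := cone_radius z; have r0 : 0 <= r by exact: cone_radius_ge0.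
pose e' := e ^+ 2 / (4 * (r + 1) ^+ 2).
have q0 : 0 < 4 * (r + 1) ^+ 2 by rewrite mulr_gt0// exprn_gt0//; lra.
have e'0 : 0 < e' by rewrite divr_gt0// exprn_gt0.
have /cvgr_dist_lt/(_ _ e'0)/nbhs_ballP[u /= u0 ub] :=
  @continuous_cos R (0 : R).
have D0 : 0 < d.+1%:R :> R by rewrite ltr0n.
(* The cap 1 gives s <= r + 1, the cap [e / 2] controls the radial term, and the last one brings the
   base distance below [u], where the cosine is within [e'] of 1. *)
pose k := Num.min (Num.min 1 (e / 2)) (u / (2 * d.+1%:R)).
have k0 : 0 < k by rewrite !lt_min ltr01 !divr_gt0// mulr_gt0.
have k1 : k <= 1 by rewrite !ge_min lexx.
have ke : k <= e / 2 by rewrite !ge_min lexx orbT.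
have ku : d.+1%:R * k < u.
  have : k <= u / (2 * d.+1%:R) by rewrite !ge_min lexx !orbT.
  rewrite ler_pdivlMr ?mulr_gt0// mulrCA => h.
  by rewrite mulrC; lra.
exists k => // w hw; rewrite ltr_norml => /andP[rw1 rw2].
have L0 := eucl_dist_ge0 (cone_base z) (cone_base w).
have Lu : eucl_dist (cone_base z) (cone_base w) < u.
  by apply: le_lt_trans ku; apply: eucl_dist_le_coord (ltW k0) => i; exact/ltW/hw.
have c1 : 1 - cos_pi (eucl_dist (cone_base z) (cone_base w)) < e'.
  set L := eucl_dist _ _ in L0 Lu *.
  have m0 : 0 <= Num.min L pi by rewrite le_min L0 pi_ge0.
  have : ball (0 : R) u (Num.min L pi).
    rewrite -ball_normE/= sub0r normrN ger0_norm//.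
    by rewrite (le_lt_trans _ Lu)// ge_min lexx.
  by move=> /ub; rewrite cos0 => /(le_lt_trans (ler_norm _)).
have := cos_pi_le1 (eucl_dist (cone_base z) (cone_base w)).
have s0 := cone_radius_ge0 w.
rewrite -(@ltr_pXn2r _ 2)// ?nnegrE ?sqrtr_ge0 ?(ltW e0)// sqr_cone_dist -/r.
move: (cos_pi _) c1 => c c1 c2; set s := cone_radius w in s0 rw1 rw2 *.
have h1 : (r - s) ^+ 2 <= e ^+ 2 / 4 by nra.
have h2 : r * s * (1 - c) <= r * (r + 1) * (1 - c).
  by rewrite ler_wpM2r ?subr_ge0// ler_wpM2l//; lra.
have h3 : r * (r + 1) * (1 - c) <= r * (r + 1) * e'.
  by rewrite ler_wpM2l ?(ltW c1)// mulr_ge0//; lra.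
have h4 : r * (r + 1) * e' <= e ^+ 2 / 4.
  rewrite /e' mulrA ler_pdivrMr// -subr_ge0.
  rewrite (_ : _ - _ = e ^+ 2 * (r + 1)); last by field.
  by rewrite mulr_ge0 ?sqr_ge0//; lra.
have := exprn_gt0 2 e0.
by lra.
Qed.

(* Every open set is a countable union of boxes with rational data in the
   coordinates (base point, radius), the centres not necessarily belonging to
   the cone. *)
Lemma measurable_fun_cone (dT : measure_display) (T : measurableType dT)
    (f : T -> cone Omega) :
  measurable_fun setT (fun t => cone_radius (f t)) ->
  (forall i, measurable_fun setT (fun t => cone_coord i (f t))) ->
  measurable_fun setT f.
Proof.
move=> mr mc.
have h : @measurable _ (cone Omega) = <<s open >> by [].
apply: (measurability _ h) => _ [U Uo <-].
pose box (p : {ffun 'I_d -> rat} * rat * nat) : set (cone Omega) :=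
  [set z | (forall i, `|ratr (p.1.1 i) - cone_coord i z| < p.2.+1%:R^-1)
    /\ `|ratr p.1.2 - cone_radius z| < p.2.+1%:R^-1].
(* Boxes not contained in [U] are replaced by the empty set, so that the union runs over a countable
   type. *)
pose V p := if `[< box p `<=` U >] then f @^-1` box p else set0.
rewrite setTI (_ : f @^-1` U = \bigcup_p V p).
  apply: measurable_bigcup_countType => p; rewrite /V; case: ifP => // _.
  rewrite (_ : f @^-1` _ =
    (\bigcap_i ((fun t => cone_coord i (f t)) @^-1`
        ball (ratr (p.1.1 i) : R) (p.2.+1%:R^-1)))
    `&` ((fun t => cone_radius (f t)) @^-1`
        ball (ratr p.1.2 : R) (p.2.+1%:R^-1))).
    apply: measurableI.
      apply: fin_bigcap_measurable => // i _; rewrite -[X in measurable X]setTI.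
      by apply: mc => //; exact: measurable_ball.
    rewrite -[X in measurable X]setTI; apply: mr => //; exact: measurable_ball.
  rewrite -ball_normE; apply/seteqP; split=> t /= [h1 h2]; split=> // i.
  - by move=> _; exact: h1.
  - exact: h1.
apply/seteqP; split=> [t /= Ut|t [p _]]; last first.
  by rewrite /V; case: ifPn => // /asboolP; exact.
have [e e0 eU] := cone_open_dist Uo Ut.
have [k k0 kU] := cone_dist_small (f t) e0.
(* A point of the box and [f t] are each within one box radius of the centre, hence within [k] of
   each other in every coordinate. *)
have [n nk] : exists n : nat, n.+1%:R^-1 < k / 2.
  have k20 : 0 < k / 2 by lra.
  exists (Num.trunc (k / 2)^-1); rewrite invf_plt ?posrE//.
  by rewrite truncnS_gt.
have n0 : 0 < n.+1%:R^-1 :> R by rewrite invr_gt0.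
have ex (a : R) : exists q : rat, `|ratr q - a| < n.+1%:R^-1.
  move: (_^-1) n0 => u u0.
  have /rat_in_itvoo[q /=] : a - u < a + u by lra.
  by rewrite in_itv/= => qa; exists q; rewrite ltr_norml; lra.
have [q qE] := choice (fun i => ex (cone_coord i (f t))).
have [r rE] := ex (cone_radius (f t)).
exists (finfun q, r, n) => //; rewrite /V; case: ifPn => [_|/asboolP[]].
  by split=> //= i; rewrite ffunE.
move=> z [/=]; move: (_^-1) nk qE rE => u nk qE rE zc zr; apply/eU/kU.
  move=> i; have := zc i; rewrite ffunE; have := qE i.
  by rewrite !ltr_norml; lra.
by move: zr rE; rewrite !ltr_norml; lra.
Qed.

End cone_measurable.

(** * Radius and measurability of geodesic points *)

Section measurable_geodesic.
Context {R : realType} {d : nat} {Omega : domain R d}.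
Local Notation C := (cone Omega).
Implicit Types (z w : C) (s : R).

Lemma cone_radius_point : cone_radius (point : C) = 0.
Proof. exact: cone_radius_pt. Qed.

Lemma minimal_geodesic_point z w (c : R -> C) s : minimal_geodesic z w c ->
    0 < s < 1 ->
  cone_dist z (c s) = s * cone_dist z w /\
  cone_dist (c s) w = (1 - s) * cone_dist z w.
Proof.
move=> [c0 c1 cst] /andP[s0 s1].
have h0 : 0 \in `[(0 : R), 1] by rewrite in_itv/= lexx ler01.
have h1 : 1 \in `[(0 : R), 1] by rewrite in_itv/= lexx ler01.
have hs : s \in `[0, 1] by rewrite in_itv/= !ltW.
split.
  have := cst _ _ h0 hs; rewrite c0 sub0r normrN gtr0_norm//.
have := cst _ _ hs h1; rewrite c1 distrC gtr0_norm ?subr_gt0//.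
Qed.

Lemma sqr_cone_radius_geodesic z w (c : R -> C) s : minimal_geodesic z w c ->
    s \in `[0, 1] ->
  cone_radius (c s) ^+ 2 = (1 - s) ^+ 2 * cone_radius z ^+ 2
    + s ^+ 2 * cone_radius w ^+ 2
    + 2 * s * (1 - s) * (cone_radius z * cone_radius w
      * cos_pi (eucl_dist (cone_base z) (cone_base w))).
Proof.
move=> gc; rewrite in_itv/= => /andP[]; have [c0 c1 _] := gc.
(* The endpoints are treated directly, as [cone_geodesic_point] requires [0 < s < 1]. *)
rewrite le_eqVlt => /orP[/eqP <- _|s0]; first by rewrite c0; ring.
rewrite le_eqVlt => /orP[/eqP ->|s1]; first by rewrite c1; ring.
have s01 : 0 < s < 1 by rewrite s0.
have [h0 h1] := minimal_geodesic_point gc s01.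
have [-> _] := cone_geodesic_point s01 h0 h1.
by rewrite sqr_geo_radius ?ltW//; ring.
Qed.

Let mfst : measurable_fun setT (fun p : C * C => p.1).
Proof. exact: measurable_fst. Qed.

Let msnd : measurable_fun setT (fun p : C * C => p.2).
Proof. exact: measurable_snd. Qed.

Let mr1 : measurable_fun setT (fun p : C * C => cone_radius p.1).
Proof. exact: measurableT_comp measurable_cone_radius mfst. Qed.

Let mr2 : measurable_fun setT (fun p : C * C => cone_radius p.2).
Proof. exact: measurableT_comp measurable_cone_radius msnd. Qed.

Let mc1 i : measurable_fun setT (fun p : C * C => cone_coord i p.1).
Proof. exact: measurableT_comp (measurable_cone_coord i) mfst. Qed.

Let mc2 i : measurable_fun setT (fun p : C * C => cone_coord i p.2).
Proof. exact: measurableT_comp (measurable_cone_coord i) msnd. Qed.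

Lemma measurable_eucl_dist_base : measurable_fun setT
  (fun p : C * C => eucl_dist (cone_base p.1) (cone_base p.2)).
Proof.
apply: measurable_fun_sqrt; apply: measurable_sum => i.
apply: measurable_funX; apply: eq_measurable_fun (measurable_funB (mc1 i) (mc2 i)).
by move=> p _; rewrite !mxE.
Qed.

Let mcos : measurable_fun setT
  (fun p : C * C => cos_pi (eucl_dist (cone_base p.1) (cone_base p.2))).
Proof. exact: measurable_fun_cos_pi measurable_eucl_dist_base. Qed.

Lemma measurable_cone_dot : measurable_fun setT (fun p : C * C =>
  cone_radius p.1 * cone_radius p.2
  * cos_pi (eucl_dist (cone_base p.1) (cone_base p.2))).
Proof. by do !apply: measurable_funM. Qed.

Lemma measurable_geo_radius s :
  measurable_fun setT (fun p : C * C => geo_radius s p.1 p.2).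
Proof.
apply: measurable_fun_sqrt; apply: measurable_funD.
  by apply: measurable_funD; apply: measurable_funX; exact: measurable_funM.
by apply: measurable_funM => //; apply: measurable_funM; do !apply: measurable_funM.
Qed.

Lemma measurable_geo_angle s :
  measurable_fun setT (fun p : C * C => geo_angle s p.1 p.2).
Proof.
apply: measurableT_comp measurable_acos_trunc _.
apply: measurable_fun_div_ge0 => [p||]; first exact: sqrtr_ge0.
  by apply: measurable_funD; do !apply: measurable_funM.
exact: measurable_geo_radius.
Qed.

(** The geodesic property alone forces the radius and the base coordinates of [Z s] to be explicit
    measurable functions of the endpoints, which suffices by [measurable_fun_cone]. *)
Lemma measurable_geodesic (Z : R -> C -> C -> C) s :
    (forall z w, minimal_geodesic z w (fun t => Z t z w)) ->
    s \in `[0, 1] ->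
  measurable_fun setT (fun p : C * C => Z s p.1 p.2).
Proof.
move=> gZ; rewrite in_itv/= => /andP[].
rewrite le_eqVlt => /orP[/eqP <- _|s0].
  rewrite (_ : (fun _ => _) = fst)//; apply/funext => p.
  by have [] := gZ p.1 p.2.
rewrite le_eqVlt => /orP[/eqP ->|s1].
  rewrite (_ : (fun _ => _) = snd)//; apply/funext => p.
  by have [] := gZ p.1 p.2.
have s01 : 0 < s < 1 by rewrite s0.
have rE p : cone_radius (Z s p.1 p.2) = geo_radius s p.1 p.2.
  have [h0 h1] := minimal_geodesic_point (gZ p.1 p.2) s01.
  by have [] := cone_geodesic_point s01 h0 h1.
apply: measurable_fun_cone => [|i].
  by apply: eq_measurable_fun (measurable_geo_radius s) => p _; rewrite rE.
(* Where the radius vanishes, the geodesic point is the tip, with its fixed representative base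
   point. *)
pose g (p : C * C) : R :=
  if geo_radius s p.1 p.2 == 0 then cone_coord i (point : C) else
  cone_coord i p.1 + geo_angle s p.1 p.2
    / Num.min (eucl_dist (cone_base p.1) (cone_base p.2)) pi
    * (cone_coord i p.2 - cone_coord i p.1).
have mg : measurable_fun setT g.
  apply: measurable_fun_ifT => //.
    by apply: measurable_fun_eqr => //; exact: measurable_geo_radius.
  apply: measurable_funD => //; apply: measurable_funM; last exact: measurable_funB.
  apply: measurable_fun_div_ge0 => [p||].
  - by rewrite le_min eucl_dist_ge0 pi_ge0.
  - exact: measurable_geo_angle.
  - by apply: measurable_minr => //; exact: measurable_eucl_dist_base.
apply: eq_measurable_fun mg => p _; rewrite /g; case: ifPn => [/eqP r0|rn0].
  by congr cone_coord; apply: cone_radius0; rewrite ?rE ?cone_radius_point.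
have [h0 h1] := minimal_geodesic_point (gZ p.1 p.2) s01.
by have [_ /(_ rn0 i)/esym] := cone_geodesic_point s01 h0 h1.
Qed.

End measurable_geodesic.

(** * Lifts, plans and the competitor through the tip *)

Section finite_measure_operations.
Context {R : realType} {d1 d2 : measure_display}.
Context {T1 : measurableType d1} {T2 : measurableType d2}.
Local Open Scope ereal_scope.

Section pushforward.
Variables (f : T1 -> T2) (mf : measurable_fun setT f).
Variable (m : {finite_measure set T1 -> \bar R}).

Let push : set T2 -> \bar R := pushforward m f.

Let mpre A : measurable A -> measurable (f @^-1` A).
Proof. by move=> mA; rewrite -[X in measurable X]setTI; exact: mf. Qed.

Let push0 : push set0 = 0. Proof. exact: measure0. Qed.

Let push_ge0 A : 0 <= push A. Proof. exact: measure_ge0. Qed.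

Let push_sigma_additive : semi_sigma_additive push.
Proof.
move=> F mF tF mUF; rewrite /push /pushforward preimage_bigcup.
apply: measure_semi_sigma_additive => [n||].
- exact: mpre.
- apply/trivIsetP => i j _ _ ij; rewrite -preimage_setI.
  by move/trivIsetP : tF => /(_ _ _ _ _ ij) ->//; rewrite preimage_set0.
- by rewrite -preimage_bigcup; exact: mpre.
Qed.

HB.instance Definition _ := isMeasure.Build _ _ _ push
  push0 push_ge0 push_sigma_additive.

Let push_fin : fin_num_fun push.
Proof. by move=> A mA; apply: fin_num_measure; exact: mpre. Qed.

HB.instance Definition _ := Measure_isFinite.Build _ _ _ push push_fin.

Definition finite_pushforward : {finite_measure set T2 -> \bar R} := push.

Lemma ge0_integral_finite_pushforward (g : T2 -> \bar R) :
  measurable_fun setT g -> (forall y, 0 <= g y) ->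
  \int[finite_pushforward]_y g y = \int[m]_x g (f x).
Proof.
move=> mg g0; have := @ge0_integral_pushforward _ _ _ _ _ _ mf m setT g.
by rewrite preimage_setT; apply.
Qed.

End pushforward.

Section sum.
Variables m1 m2 : {finite_measure set T1 -> \bar R}.

Let sum := measure_add m1 m2.

HB.instance Definition _ := Measure.on sum.

Let sum_fin : fin_num_fun sum.
Proof.
by move=> A mA; rewrite /sum measure_addE fin_numD !fin_num_measure.
Qed.

HB.instance Definition _ := Measure_isFinite.Build _ _ _ sum sum_fin.

Definition finite_measure_add : {finite_measure set T1 -> \bar R} := sum.

Lemma ge0_integral_finite_measure_add (g : T1 -> \bar R) :
  measurable_fun setT g -> (forall x, 0 <= g x) ->
  \int[finite_measure_add]_x g x = \int[m1]_x g x + \int[m2]_x g x.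
Proof. by move=> mg g0; exact: ge0_integral_measure_add. Qed.

End sum.
End finite_measure_operations.

(** * Marginals of plans, and the bound of HK by the total masses *)

Section plans.
Context {R : realType} {d : nat} {Omega : domain R d}.
Local Notation C := (cone Omega).
Local Notation M := {finite_measure set Omega -> \bar R}.
Local Notation MC := {finite_measure set C -> \bar R}.
Implicit Types (mu : M) (lam : MC) (gam : {measure set (C * C)%type -> \bar R}).
Local Open Scope ereal_scope.

Lemma ge0_integral_plan lam0 lam1 gam (g : C -> \bar R) :
    is_plan lam0 lam1 gam -> measurable_fun setT g -> (forall z, 0 <= g z) ->
  \int[gam]_p g p.1 = \int[lam0]_z g z /\ \int[gam]_p g p.2 = \int[lam1]_z g z.
Proof.
move=> plan mg g0.
have m1 : measurable_fun setT (@fst C C) by exact: measurable_fst.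
have m2 : measurable_fun setT (@snd C C) by exact: measurable_snd.
have h1 := @ge0_integral_pushforward _ _ _ _ _ _ m1 gam setT g.
have h2 := @ge0_integral_pushforward _ _ _ _ _ _ m2 gam setT g.
rewrite preimage_setT in h1 h2; split.
- transitivity (\int[pushforward gam fst]_z g z); first by rewrite h1.
  by apply: eq_measure_integral => A mA _; have [] := plan A mA.
- transitivity (\int[pushforward gam snd]_z g z); first by rewrite h2.
  by apply: eq_measure_integral => A mA _; have [] := plan A mA.
Qed.

(** Test with the constant function 1. A bare set function [lam] makes this apply to the pushforward
    along the geodesic as well. *)
Lemma mass_projection (lam : set C -> \bar R) mu : is_projection lam mu ->
  mu setT = \int[lam]_z (cone_radius z ^+ 2)%:E.
Proof.
move=> proj; have /proj : continuous (fun _ : Omega => 1%R : R).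
  exact: cst_continuous.
rewrite integral_cst// mul1e => ->; congr integral.
by apply/funext => z; rewrite mulr1.
Qed.

Lemma measurable_sqr_cone_radius :
  measurable_fun setT (fun z : C => (cone_radius z ^+ 2)%:E).
Proof.
by apply/measurable_EFinP/measurable_funX; exact: measurable_cone_radius.
Qed.

Lemma cone_dist_point (z : C) : cone_dist z point = cone_radius z.
Proof.
rewrite /cone_dist cone_radius_point -[RHS]ger0_norm ?cone_radius_ge0//.
by rewrite -sqrtr_sqr; congr Num.sqrt; ring.
Qed.

Let mfst : measurable_fun setT (@fst C C). Proof. exact: measurable_fst. Qed.

Let msnd : measurable_fun setT (@snd C C). Proof. exact: measurable_snd. Qed.

Let pair_point (z : C) : C * C := (z, point).

Let point_pair (z : C) : C * C := (point, z).

Let mpair_point : measurable_fun setT pair_point.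
Proof. exact: pair2_measurable. Qed.

Let mpoint_pair : measurable_fun setT point_pair.
Proof. exact: pair1_measurable. Qed.

(* All the mass of [lam0] is sent to the tip and all the mass of [lam1] comes
   from the tip. *)
Definition tip_plan lam0 lam1 : {finite_measure set (C * C)%type -> \bar R} :=
  finite_measure_add (finite_pushforward mpair_point lam0)
                     (finite_pushforward mpoint_pair lam1).

Lemma ge0_integral_tip_plan lam0 lam1 (g : (C * C)%type -> \bar R) :
    measurable_fun setT g -> (forall p, 0 <= g p) ->
  \int[tip_plan lam0 lam1]_p g p =
  \int[lam0]_z g (z, point) + \int[lam1]_z g (point, z).
Proof.
move=> mg g0; rewrite ge0_integral_finite_measure_add//.
by congr (_ + _); exact: ge0_integral_finite_pushforward.
Qed.

Definition tip_marginal0 lam0 lam1 : MC :=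
  finite_pushforward mfst (tip_plan lam0 lam1).

Definition tip_marginal1 lam0 lam1 : MC :=
  finite_pushforward msnd (tip_plan lam0 lam1).

(** Positive and negative parts of [g] vanish at the tip too. *)
Let parts (m m' : MC) (g : C -> \bar R) : measurable_fun setT g -> g point = 0 ->
  (forall h : C -> \bar R, measurable_fun setT h -> (forall z, 0 <= h z) ->
     h point = 0 -> \int[m]_z h z = \int[m']_z h z) ->
  \int[m]_z g z = \int[m']_z g z.
Proof.
move=> mg g0 ge0; rewrite integralE [RHS]integralE; congr (_ - _).
- apply: ge0 => //; first exact: measurable_funepos.
  by rewrite funeposE g0 maxxx.
- apply: ge0 => //; first exact: measurable_funeneg.
  by rewrite funenegE g0 oppe0 maxxx.
Qed.

(** The mass added to [lam0] sits at the tip, where [g] vanishes. *)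
Lemma integral_tip_marginal0 lam0 lam1 (g : C -> \bar R) :
  measurable_fun setT g -> g point = 0 ->
  \int[tip_marginal0 lam0 lam1]_z g z = \int[lam0]_z g z.
Proof.
move=> mg g0; apply: parts => // h mh h0 hp.
transitivity (\int[tip_plan lam0 lam1]_p h p.1).
  exact: ge0_integral_finite_pushforward.
transitivity (\int[lam0]_z h z + \int[lam1]_z h point).
  apply: (@ge0_integral_tip_plan lam0 lam1 (h \o fst)) => [|p]; last exact: h0.
  exact: measurableT_comp mh mfst.
by rewrite hp integral0 adde0.
Qed.

Lemma integral_tip_marginal1 lam0 lam1 (g : C -> \bar R) :
  measurable_fun setT g -> g point = 0 ->
  \int[tip_marginal1 lam0 lam1]_z g z = \int[lam1]_z g z.
Proof.
move=> mg g0; apply: parts => // h mh h0 hp.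
transitivity (\int[tip_plan lam0 lam1]_p h p.2).
  exact: ge0_integral_finite_pushforward.
transitivity (\int[lam0]_z h point + \int[lam1]_z h z).
  apply: (@ge0_integral_tip_plan lam0 lam1 (h \o snd)) => [|p]; last exact: h0.
  exact: measurableT_comp mh msnd.
by rewrite hp integral0 add0e.
Qed.

(** Both conditions on a lift integrate functions with a factor r^2, which are blind to mass at the
    tip. *)
Let lift_eq mu lam lam' : is_lift mu lam ->
  (forall g : C -> \bar R, measurable_fun setT g -> g point = 0 ->
     \int[lam']_z g z = \int[lam]_z g z) ->
  is_lift mu lam'.
Proof.
move=> [fsm proj] eqi; split.
  rewrite /finite_second_moment eqi//; first exact: measurable_sqr_cone_radius.
  by rewrite cone_radius_point expr0n.
move=> phi cphi; rewrite eqi; first exact: proj.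
  apply/measurable_EFinP; apply: measurable_funM.
    by apply: measurable_funX; exact: measurable_cone_radius.
  exact: measurable_continuous_cone_base.
by rewrite cone_radius_point expr0n mul0r.
Qed.

Lemma tip_marginal0_lift mu lam0 lam1 :
  is_lift mu lam0 -> is_lift mu (tip_marginal0 lam0 lam1).
Proof. by move=> /lift_eq; apply => g; exact: integral_tip_marginal0. Qed.

Lemma tip_marginal1_lift mu lam0 lam1 :
  is_lift mu lam1 -> is_lift mu (tip_marginal1 lam0 lam1).
Proof. by move=> /lift_eq; apply => g; exact: integral_tip_marginal1. Qed.

Lemma measurable_sqr_mdist :
  measurable_fun setT (fun p : (C * C)%type => (mdist p.1 p.2 ^+ 2)%:E).
Proof.
apply/measurable_EFinP; apply: (@eq_measurable_fun _ _ _ _ setT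
  (fun p : (C * C)%type => cone_radius p.1 ^+ 2 + cone_radius p.2 ^+ 2
    - 2 * (cone_radius p.1 * cone_radius p.2
      * cos_pi (eucl_dist (cone_base p.1) (cone_base p.2))))%R).
  by move=> p _; rewrite -[mdist _ _]/(cone_dist _ _) sqr_cone_dist !mulrA.
apply: measurable_funB; last first.
  by apply: measurable_funM => //; exact: measurable_cone_dot.
by apply: measurable_funD; apply: measurable_funX;
  exact: measurableT_comp measurable_cone_radius _.
Qed.

Lemma cone_wasserstein_ge0 lam0 lam1 : 0 <= cone_wasserstein lam0 lam1.
Proof. exact: sqrte_ge0. Qed.

Lemma HK_ge0 mu0 mu1 : 0 <= HK mu0 mu1.
Proof.
by apply: le_ereal_inf_tmp => _ [l _ <-]; exact: cone_wasserstein_ge0.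
Qed.

Lemma transport_cost_ge0 gam : 0 <= transport_cost gam.
Proof. by apply: integral_ge0 => p _; rewrite lee_fin sqr_ge0. Qed.

(** The distance to the tip is the radius, so [tip_plan] costs the sum of the two second moments,
    which are the masses. Its marginals are again lifts, hence admissible for [HK]. *)
Lemma sqr_HK_le_mass mu0 mu1 lam0 lam1 : is_lift mu0 lam0 -> is_lift mu1 lam1 ->
  HK mu0 mu1 ^+ 2 <= mu0 setT + mu1 setT.
Proof.
move=> lift0 lift1.
have -> : mu0 setT + mu1 setT = transport_cost (tip_plan lam0 lam1).
  rewrite (mass_projection lift0.2) (mass_projection lift1.2).
  rewrite /transport_cost ge0_integral_tip_plan//; last first.
    by move=> p; rewrite lee_fin sqr_ge0.
    exact: measurable_sqr_mdist.
  congr (_ + _); apply: eq_integral => z _; rewrite -[mdist _ _]/(cone_dist _ _).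
    by rewrite cone_dist_point.
  by rewrite cone_dist_sym cone_dist_point.
set cost := transport_cost _; have c0 : 0 <= cost by exact: transport_cost_ge0.
rewrite -[leRHS]sqr_sqrte// lee_sqr ?HK_ge0 ?sqrte_ge0//.
apply: (@le_trans _ _
  (cone_wasserstein (tip_marginal0 lam0 lam1) (tip_marginal1 lam0 lam1))).
  apply: ereal_inf_lbound.
  exists (tip_marginal0 lam0 lam1, tip_marginal1 lam0 lam1) => //=.
  by split; [exact: tip_marginal0_lift | exact: tip_marginal1_lift].
rewrite lee_sqrt//; apply: ereal_inf_lbound.
by exists (tip_plan lam0 lam1).
Qed.

End plans.

(** * Mass along the geodesic *)

Section quadratic.
Context {R : realType}.

(** For t different from s in the interval, the difference quotient is [c1 + c2 * (t + s)]. *)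
Lemma derivative_on_quadratic (f : R -> R) (c0 c1 c2 : R) :
  (forall s, s \in `[0, 1] -> f s = c0 + c1 * s + c2 * s ^+ 2) ->
  derivative_on `[0, 1] f (fun s => c1 + 2 * c2 * s).
Proof.
move=> fE s s01.
have sub : within `[0, 1] s^' `=>` nbhs s.
  by apply: cvg_trans; [exact: cvg_within | exact: cvg_within].
have lim : c1 + c2 * (t + s) @[t --> within `[0, 1] s^'] --> c1 + 2 * c2 * s.
  rewrite (_ : c1 + _ = c1 + c2 * (s + s)); last by ring.
  apply: cvg_trans (cvg_app _ sub) _.
  apply: cvgD; first exact: cvg_cst.
  by apply: cvgMr; apply: cvgD; [exact: cvg_id | exact: cvg_cst].
apply: cvg_trans lim; apply: near_eq_cvg.
rewrite !near_withinE; apply: nearW => t ts t01.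
rewrite !fE//; field; rewrite subr_eq0.
exact: ts.
Qed.

(** A discriminant argument with nonnegative [k] and [l] only, because the integrand in
    [plan_cauchy_schwarz] has a term whose sign is that of [k * l]. *)
Lemma le_sqrt_of_quadratic (a b c : R) : 0 <= a -> 0 <= b ->
  (forall k l, 0 <= k -> 0 <= l ->
     0 <= k ^+ 2 * a + l ^+ 2 * b - 2 * (k * l) * c) ->
  c <= Num.sqrt a * Num.sqrt b.
Proof.
have zero (x y : R) : 0 <= y ->
    (forall k : R, 0 <= k -> 0 <= y - 2 * k * x) -> x <= 0.
  move=> y0 h; rewrite leNgt; apply/negP => x0.
  (* This [k] makes y - 2kx equal to -1. *)
  have k0 : 0 <= (y + 1) / (2 * x) by rewrite divr_ge0//; lra.
  have := h _ k0; rewrite (_ : 2 * _ * x = y + 1); first by lra.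
  by field; rewrite gt_eqF.
move=> a0 b0 h.
have [a00|an0] := eqVneq a 0.
  rewrite a00 sqrtr0 mul0r; apply: zero b0 _ => k k0.
  by have := h k 1 k0 ler01; rewrite a00; lra.
have [b00|bn0] := eqVneq b 0.
  rewrite b00 sqrtr0 mulr0; apply: zero a0 _ => k k0.
  by have := h 1 k ler01 k0; rewrite b00; lra.
have ap : 0 < Num.sqrt a by rewrite sqrtr_gt0 lt_def an0.
have bp : 0 < Num.sqrt b by rewrite sqrtr_gt0 lt_def bn0.
have ab : 0 < Num.sqrt a * Num.sqrt b by rewrite mulr_gt0.
(* With k = sqrt b and l = sqrt a, the form factors through sqrt a sqrt b - c. *)
have := h _ _ (ltW bp) (ltW ap); rewrite !sqr_sqrtr//.
move: (sqr_sqrtr a0) (sqr_sqrtr b0) ab; set u := Num.sqrt a; set v := Num.sqrt b.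
move=> <- <- uv.
rewrite (_ : _ - _ = 2 * (u * v) * (u * v - c)); last by ring.
by rewrite pmulr_rge0 ?subr_ge0// mulr_gt0.
Qed.

End quadratic.

(** * Integrals of quadratic expressions in the radii against a plan *)

Section plan_integrals.
Context {R : realType} {d : nat} {Omega : domain R d}.
Local Notation C := (cone Omega).
Variables (mu0 mu1 : {finite_measure set Omega -> \bar R}).
Variables (lam0 lam1 : {finite_measure set C -> \bar R}).
Variable (gam : {measure set (C * C)%type -> \bar R}).
Hypotheses (lift0 : is_lift mu0 lam0) (lift1 : is_lift mu1 lam1).
Hypothesis plan : is_plan lam0 lam1 gam.
Local Open Scope ereal_scope.

Let r0 (p : (C * C)%type) : R := cone_radius p.1.
Let r1 (p : (C * C)%type) : R := cone_radius p.2.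

Definition cone_dot (p : (C * C)%type) : R :=
  (cone_radius p.1 * cone_radius p.2
   * cos_pi (eucl_dist (cone_base p.1) (cone_base p.2)))%R.

Let mr0 : measurable_fun setT (fun p => r0 p ^+ 2)%R.
Proof.
by apply: measurable_funX; apply: measurableT_comp measurable_cone_radius _.
Qed.

Let mr1 : measurable_fun setT (fun p => r1 p ^+ 2)%R.
Proof.
by apply: measurable_funX; apply: measurableT_comp measurable_cone_radius _.
Qed.

Let mdot : measurable_fun setT cone_dot.
Proof. exact: measurable_cone_dot. Qed.

Let ir0E : \int[gam]_p (r0 p ^+ 2)%:E = (fine (mu0 setT))%:E.
Proof.
rewrite fineK ?fin_num_measure// (mass_projection lift0.2).
have [] := ge0_integral_plan plan measurable_sqr_cone_radius => // z.
by rewrite lee_fin sqr_ge0.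
Qed.

Let ir1E : \int[gam]_p (r1 p ^+ 2)%:E = (fine (mu1 setT))%:E.
Proof.
rewrite fineK ?fin_num_measure// (mass_projection lift1.2).
have [] := ge0_integral_plan plan measurable_sqr_cone_radius => // z.
by rewrite lee_fin sqr_ge0.
Qed.

Let ir0 : gam.-integrable setT (fun p => (r0 p ^+ 2)%:E).
Proof.
apply/integrableP; split; first exact/measurable_EFinP.
under eq_integral do rewrite gee0_abs ?lee_fin ?sqr_ge0//.
by rewrite ir0E ltry.
Qed.

Let ir1 : gam.-integrable setT (fun p => (r1 p ^+ 2)%:E).
Proof.
apply/integrableP; split; first exact/measurable_EFinP.
under eq_integral do rewrite gee0_abs ?lee_fin ?sqr_ge0//.
by rewrite ir1E ltry.
Qed.

(** Domination by r0^2 + r1^2. As [cone_dot] changes sign, linearity of the integral rests on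
    this. *)
Let idot : gam.-integrable setT (fun p => (cone_dot p)%:E).
Proof.
apply: le_integrable (integrableD measurableT ir0 ir1) => //.
  exact/measurable_EFinP.
move=> p _; rewrite -EFinD !abse_EFin lee_fin.
rewrite [leRHS]ger0_norm ?addr_ge0 ?sqr_ge0// /cone_dot ler_norml.
have := cos_pi_le1 (eucl_dist (cone_base p.1) (cone_base p.2)).
have := cos_pi_ge0 (eucl_dist (cone_base p.1) (cone_base p.2)).
rewrite /r0 /r1; have := cone_radius_ge0 p.1; have := cone_radius_ge0 p.2.
move: (cos_pi _) (cone_radius _) (cone_radius _) => c x y x0 y0 c0 c1.
have xy : (0 <= x * y)%R by rewrite mulr_ge0.
have := sqr_ge0 (x - y)%R.
have h1 : (0 <= (x * y) * (1 - c))%R by rewrite mulr_ge0// subr_ge0.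
have h2 : (0 <= (x * y) * (1 + c))%R by rewrite mulr_ge0//; lra.
by move=> h3; apply/andP; split; nra.
Qed.

Lemma integral_cone_dot_fin_num : \int[gam]_p (cone_dot p)%:E \is a fin_num.
Proof. exact: integrable_fin_num idot. Qed.

(** One computation serves the cost (1, 1, -2), the mass ((1-s)^2, s^2, 2s(1-s)) and Cauchy-Schwarz
    (k^2, l^2, -2kl). *)
Lemma integral_plan_quadratic (k0 k1 k2 : R) :
  \int[gam]_p (k0 * cone_radius p.1 ^+ 2 + k1 * cone_radius p.2 ^+ 2
    + k2 * cone_dot p)%:E =
  (k0 * fine (mu0 setT) + k1 * fine (mu1 setT)
    + k2 * fine (\int[gam]_p (cone_dot p)%:E))%:E.
Proof.
have i0 := integrableZl measurableT k0 ir0.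
have i1 := integrableZl measurableT k1 ir1.
have i2 := integrableZl measurableT k2 idot.
transitivity (\int[gam]_p ((k0%:E * (r0 p ^+ 2)%:E + k1%:E * (r1 p ^+ 2)%:E)
    + k2%:E * (cone_dot p)%:E)); first by apply: eq_integral.
rewrite integralD//; last exact: integrableD.
rewrite integralD// !integralZl// ir0E ir1E.
by rewrite !EFinD !EFinM (fineK integral_cone_dot_fin_num).
Qed.

Lemma transport_cost_plan : transport_cost gam =
  (fine (mu0 setT) + fine (mu1 setT)
    - 2 * fine (\int[gam]_p (cone_dot p)%:E))%:E.
Proof.
transitivity (\int[gam]_p (1 * cone_radius p.1 ^+ 2 + 1 * cone_radius p.2 ^+ 2
    + (- 2) * cone_dot p)%:E); last first.
  by rewrite integral_plan_quadratic; congr EFin; ring.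
apply: eq_integral => p _; rewrite -[mdist _ _]/(cone_dist _ _) sqr_cone_dist.
by congr EFin; rewrite /cone_dot; ring.
Qed.

(** The form integrates (k r0 - l r1)^2 + 2 k l r0 r1 (1 - cos_pi), which is nonnegative for k, l >=
    0. *)
Lemma plan_cauchy_schwarz : (fine (\int[gam]_p (cone_dot p)%:E) <=
  Num.sqrt (fine (mu0 setT)) * Num.sqrt (fine (mu1 setT)))%R.
Proof.
apply: le_sqrt_of_quadratic => [||k l k0 l0]; [exact: fine_ge0..|].
rewrite -lee_fin (_ : (_ - _)%R = (k ^+ 2 * fine (mu0 setT)
    + l ^+ 2 * fine (mu1 setT)
    + (- 2 * (k * l)) * fine (\int[gam]_p (cone_dot p)%:E))%R); last by ring.
rewrite -integral_plan_quadratic; apply: integral_ge0 => p _.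
rewrite lee_fin /cone_dot.
have := cos_pi_le1 (eucl_dist (cone_base p.1) (cone_base p.2)).
have := cone_radius_ge0 p.1; have := cone_radius_ge0 p.2.
move: (cos_pi _) (cone_radius _) (cone_radius _) => c x y x0 y0 c1.
rewrite (_ : (_ + _)%R = ((k * x - l * y) ^+ 2
  + 2 * (k * l) * (x * y) * (1 - c))%R); last by ring.
by rewrite addr_ge0 ?sqr_ge0// !mulr_ge0// subr_ge0.
Qed.

Lemma mass_geodesic (Z : R -> C -> C -> C) (s : R)
    (mu : {finite_measure set Omega -> \bar R}) :
    (forall z w, minimal_geodesic z w (fun t => Z t z w)) -> s \in `[0%R, 1%R] ->
    is_projection (pushforward gam (fun p => Z s p.1 p.2)) mu ->
  fine (mu setT) = ((1 - s) ^+ 2 * fine (mu0 setT) + s ^+ 2 * fine (mu1 setT)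
    + 2 * s * (1 - s) * fine (\int[gam]_p (cone_dot p)%:E))%R.
Proof.
move=> gZ s01 /mass_projection ->.
have := @ge0_integral_pushforward _ _ _ _ _ _ (measurable_geodesic gZ s01) gam
  setT (fun z => (cone_radius z ^+ 2)%:E).
rewrite preimage_setT => -> //; last 2 first.
- exact: measurable_sqr_cone_radius.
- by move=> z _; rewrite lee_fin sqr_ge0.
set I := integral _ _ _.
have -> : I = ((1 - s) ^+ 2 * fine (mu0 setT) + s ^+ 2 * fine (mu1 setT)
    + 2 * s * (1 - s) * fine (\int[gam]_p (cone_dot p)%:E))%:E.
  rewrite -integral_plan_quadratic; apply: eq_integral => p _ /=.
  by rewrite (sqr_cone_radius_geodesic (gZ _ _) s01).
by [].
Qed.

End plan_integrals.

Theorem proposition5p1 (R : realType) (d : nat) (Omega : domain R d)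
    (mu0 mu1 : {finite_measure set Omega -> \bar R})
    (lam0 lam1 : {finite_measure set (cone Omega) -> \bar R})
    (gam : {measure set (cone Omega * cone Omega) -> \bar R})
    (Z : R -> cone Omega -> cone Omega -> cone Omega)
    (mu : R -> {finite_measure set Omega -> \bar R})
    (hlam : optimal_lifts mu0 mu1 lam0 lam1)
    (hgam : optimal_plan lam0 lam1 gam)
    (hZ : forall z0 z1 : cone Omega,
       minimal_geodesic z0 z1 (fun s => Z s z0 z1))
    (hmu : forall s : R, s \in `[0, 1] ->
       is_projection (pushforward gam (fun z => Z s z.1 z.2)) (mu s)) :
  let m (s : R) : R := fine (mu s setT) in
  let mstar : \bar R :=
    (\int[gam]_z (cone_radius z.1 * cone_radius z.2
                  * cos_pi (eucl_dist (cone_base z.2) (cone_base z.1)))%:E)%E in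
  (forall s : R, s \in `[0, 1] ->
     (m s)%:E = (((1 - s) ^+ 2 * m 0 + s ^+ 2 * m 1)%:E
                 + (2 * s * (1 - s))%:E * mstar)%E)
  /\ (forall s : R, s \in `[0, 1] ->
       [/\ 0 < m 0 + m 1 ->
             m 0 * m 1 / (m 0 + m 1) <= (1 - s) ^+ 2 * m 0 + s ^+ 2 * m 1,
           (1 - s) ^+ 2 * m 0 + s ^+ 2 * m 1 <= m s &
           m s <= ((1 - s) * Num.sqrt (m 0) + s * Num.sqrt (m 1)) ^+ 2])
  /\ (exists m' m'' : R -> R,
       [/\ derivative_on `[0, 1] m m',
           derivative_on `[0, 1] m' m'' &
           forall s : R, s \in `[0, 1] ->
             (m'' s)%:E = (2%:E * HK mu0 mu1 ^+ 2)%E /\ 0 <= m'' s])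
  /\ (forall s : R, s \in `[0, 1] ->
       (m s)%:E = (((1 - s) * m 0 + s * m 1)%:E
                   - (s * (1 - s))%:E * HK mu0 mu1 ^+ 2)%E).
Proof.
move=> m mstar.
have [lift0 lift1 Weq] := hlam; have [plan cost] := hgam.
set a := fine (mu0 setT); set b := fine (mu1 setT).
have a0 : 0 <= a by exact: fine_ge0.
have b0 : 0 <= b by exact: fine_ge0.
set ms := fine (\int[gam]_p (cone_dot p)%:E)%E.
have mstarE : mstar = ms%:E.
  rewrite /ms (fineK (integral_cone_dot_fin_num lift0 lift1 plan)).
  by apply: eq_integral => p _; rewrite /cone_dot eucl_dist_sym.
have mE s : s \in `[0, 1] ->
    m s = (1 - s) ^+ 2 * a + s ^+ 2 * b + 2 * s * (1 - s) * ms.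
  by move=> s01; exact: (mass_geodesic lift0 lift1 plan hZ s01 (hmu s s01)).
have m0 : m 0 = a by rewrite mE ?in_itv/= ?lexx ?ler01//; ring.
have m1 : m 1 = b by rewrite mE ?in_itv/= ?lexx ?ler01//; ring.
have costE := transport_cost_plan lift0 lift1 plan.
rewrite -/a -/b -/ms in costE.
(* Optimality of the lifts and of the plan identifies HK^2 with the cost of [gam]. *)
have HKE : (HK mu0 mu1 ^+ 2)%E = (a + b - 2 * ms)%:E.
  by rewrite -Weq -cost costE.
have HK0 : 0 <= a + b - 2 * ms.
  by rewrite -lee_fin -costE; exact: transport_cost_ge0.
have ms0 : 0 <= ms.
  have := sqr_HK_le_mass lift0 lift1.
  rewrite HKE -(fineK (fin_num_measure mu0 _ measurableT)).
  rewrite -(fineK (fin_num_measure mu1 _ measurableT)) -EFinD lee_fin.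
  by rewrite -/a -/b; lra.
have msab : ms <= Num.sqrt a * Num.sqrt b by exact: plan_cauchy_schwarz plan.
rewrite m0 m1 mstarE HKE; split.
  by move=> s s01; rewrite mE// -EFinM -EFinD.
split.
  move=> s s01; rewrite (mE _ s01).
  move: s01; rewrite in_itv/= => /andP[s0 s1].
  have s1s : 0 <= 2 * s * (1 - s) by rewrite !mulr_ge0//; lra.
  split.
  - move=> ab; rewrite ler_pdivrMr// -subr_ge0.
    (* After clearing the denominator, the difference is a perfect square. *)
    rewrite (_ : _ - _ = ((1 - s) * a - s * b) ^+ 2); last by ring.
    exact: sqr_ge0.
  - by rewrite lerDl mulr_ge0.
  - rewrite -subr_ge0 -[in X in _ - X](sqr_sqrtr a0) -[in X in _ - X](sqr_sqrtr b0).
    rewrite (_ : _ - _ = 2 * s * (1 - s) * (Num.sqrt a * Num.sqrt b - ms)).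
      by rewrite mulr_ge0// subr_ge0.
    by ring.
split; last first.
  by move=> s s01; rewrite mE// -EFinM -EFinB; congr EFin; ring.
(* In powers of s, the mass is a + 2 (ms - a) s + (a + b - 2 ms) s^2, with leading coefficient
   HK^2. *)
exists (fun s => 2 * (ms - a) + 2 * (a + b - 2 * ms) * s).
exists (fun=> 2 * (a + b - 2 * ms)); split.
- apply: (derivative_on_quadratic (c0 := a)) => s s01.
  by rewrite mE//; ring.
- have -> : (fun=> 2 * (a + b - 2 * ms)) =
      (fun s => 2 * (a + b - 2 * ms) + 2 * 0 * s) :> (R -> R).
    by apply/funext => s; ring.
  by apply: (derivative_on_quadratic (c0 := 2 * (ms - a))) => s _; ring.
- by move=> s _; split; [rewrite EFinM | rewrite mulr_ge0].
Qed.
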